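(* If a program $P$ is typable in the stratified affine-intuitionistic type and effect system, i.e. $R;\Gamma\vdash P:(\alpha,e)$ is derivable for some $R,\Gamma,\alpha,e$, then every reduction sequence $P\to P_1\to P_2\to\cdots$ starting from $P$ is finite.
   Context: Syntax. Variables $x,y,\dots$. Values $V ::= * \mid x \mid \lambda x.M \mid\ !V$. Terms $M ::= V \mid MM \mid\ !M \mid \mathsf{let}\ !x = M\ \mathsf{in}\ M \mid \nu x\,M \mid \mathsf{set}(x,V) \mid \mathsf{pset}(x,V) \mid \mathsf{get}(x) \mid (M\mid M)$. Stores $S ::= (x\leftarrow V) \mid (x \Leftarrow V) \mid (S\mid S)$ (volatile resp. persistent store items). Programs $P ::= M \mid S \mid (P\mid P) \mid \nu x\,P$. The binders $\lambda x$, $\nu x$, $\mathsf{let}\ !x$ bind $x$. Evaluation contexts $E ::= [\,] \mid EM \mid VE \mid\ !E \mid \mathsf{let}\ !x = E\ \mathsf{in}\ M$; static contexts $C ::= [\,] \mid (C\mid P)\mid (P\mid C)\mid \nu x\,C$. Structural equivalence $\equiv$ is the least equivalence on programs closed under static contexts and containing $\alpha$-renaming, $P\mid P'\equiv P'\mid P$, $(P\mid P')\mid P''\equiv P\mid(P'\mid P'')$, $(\nu x\,P)\mid P'\equiv \nu x(P\mid P')$ if $x\notin FV(P')$, and $E[\nu x\,M]\equiv \nu x\,E[M]$ if $x\notin FV(E)$. Reduction: $P\to P'$ iff $P\equiv C[\Delta]$ and $P'\equiv C[\Delta']$ for some static context $C$ and basic step among: $E[(\lambda x.M)V]\to E[[V/x]M]$;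 $E[\mathsf{let}\ !x=\,!V\ \mathsf{in}\ M]\to E[[V/x]M]$; $E[\mathsf{set}(x,V)]\to E[*]\mid(x\leftarrow V)$; $E[\mathsf{pset}(x,V)]\to E[*]\mid(x\Leftarrow V)$; $E[\mathsf{get}(x)]\mid(x\leftarrow V)\to E[V]$; $E[\mathsf{get}(x)]\mid(x\Leftarrow\, !V)\to E[!V]\mid(x\Leftarrow\, !V)$. Types and effects. Regions $r,r',\dots$ are each volatile or persistent; an effect $e$ is a finite set of regions. Types $\alpha ::= \mathbf{B}\mid A$, value-types $A ::= \mathbf{1}\mid A\multimap^{e}\alpha \mid\ !A\mid \mathrm{Reg}_r A$. Usages: on $\{0,1,\infty\}$ the partial sum $\uplus$ has $a\uplus 0=0\uplus a=a$, $\infty\uplus\infty=\infty$, undefined otherwise. A context is $\Gamma = x_1:(u_1,A_1),\dots,x_n:(u_n,A_n)$, distinct $x_i$, $u_i\in\{1,\infty\}$. A region usage $U=(v,v')$ (output, input) lies in one of $\{(\infty,\infty)\}$, $\{(1,\infty),(0,\infty)\}$, $\{(0,0),(1,0),(0,1),(1,1)\}$; $U_1\uplus U_2$ is defined iff both lie in the same set and the componentwise sum is defined. A region context is an ordered list $R=r_1:(U_1,A_1),\dots,r_n:(U_n,A_n)$ with distinct $r_i$. Sums of contexts and region contexts are componentwise (domains of region contexts implicitly equalized with neutral usages $(\infty,\infty)$, $(0,\infty)$, $(0,0)$). Stratified formation rules: $\emptyset\vdash$; if $R\vdash A$ and $r\notin\mathrm{dom}(R)$ then $R,r:(U,A)\vdash$;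 if $R\vdash$ then $R\vdash\mathbf{1}$ and $R\vdash\mathbf{B}$; if $R\vdash A$ then $R\vdash\, !A$; if $R\vdash A$, $R\vdash\alpha$, $e\subseteq\mathrm{dom}(R)$ then $R\vdash A\multimap^e\alpha$; if $R\vdash$ and $r:(U,A)\in R$ then $R\vdash\mathrm{Reg}_rA$; if $R\vdash\alpha$ and $e\subseteq\mathrm{dom}(R)$ then $R\vdash(\alpha,e)$; $R\vdash\Gamma$ iff $R\vdash A$ for all $x:(u,A)\in\Gamma$. (Thus a value stored in region $r$ can only have latent effects on regions declared before $r$.) $\mathrm{aff}(x:(u,A))$ iff $u=1$; $\mathrm{aff}(r:((v,v'),A))$ iff $1\in\{v,v'\}$ or ($r$ volatile and $v'\neq 0$); $\mathrm{aff}(R;\Gamma)$: some hypothesis satisfies $\mathrm{aff}$; $\mathrm{saff}(R;\Gamma)$: all do. Subtyping: $R\vdash\alpha\le\alpha$; $R\vdash A\le A'$ gives $R\vdash\, !A\le\, !A'$; $e\subseteq e'\subseteq\mathrm{dom}(R)$, $R\vdash A'\le A$, $R\vdash\alpha\le\alpha'$ give $R\vdash (A\multimap^e\alpha)\le(A'\multimap^{e'}\alpha')$; $e\subseteq e'\subseteq\mathrm{dom}(R)$, $R\vdash\alpha\le\alpha'$ give $R\vdash(\alpha,e)\le(\alpha',e')$. Typing rules for $R;\Gamma\vdash P:(\alpha,e)$ (all well-formedness premises understood with the stratified rules): (sub) from $R;\Gamma\vdash M:(\alpha,e)$ and $R\vdash(\alpha,e)\le(\alpha',e')$ infer $R;\Gamma\vdash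 M:(\alpha',e')$. (var) $R\vdash\Gamma$, $x:(u,A)\in\Gamma$ give $x:(A,\emptyset)$. (unit) $R\vdash\Gamma$ gives $*:(\mathbf{1},\emptyset)$. (abs) $R;\Gamma,x:(1,A)\vdash M:(\alpha,e)$ gives $R;\Gamma\vdash\lambda x.M:(A\multimap^e\alpha,\emptyset)$. (app) $R_1;\Gamma_1\vdash M:(A\multimap^e\alpha,e')$, $R_2;\Gamma_2\vdash N:(A,e'')$ give $R_1\uplus R_2;\Gamma_1\uplus\Gamma_2\vdash MN:(\alpha,e\cup e'\cup e'')$. (prom) $R\uplus R'\vdash\Gamma\uplus\Gamma'$, $\mathrm{saff}(R';\Gamma')$, $R;\Gamma\vdash M:(A,e)$, $\neg\mathrm{aff}(R;\Gamma)$ give $R\uplus R';\Gamma\uplus\Gamma'\vdash\, !M:(!A,e)$. (let) $R_1;\Gamma_1\vdash M:(!A,e)$, $R_2;\Gamma_2,x:(\infty,A)\vdash N:(\alpha,e')$ give $R_1\uplus R_2;\Gamma_1\uplus\Gamma_2\vdash\mathsf{let}\ !x=M\ \mathsf{in}\ N:(\alpha,e\cup e')$. (new) $R;\Gamma,x:(u,\mathrm{Reg}_rA)\vdash P:(\alpha,e)$ gives $R;\Gamma\vdash\nu x\,P:(\alpha,e)$. (get) $R\vdash\Gamma$, $x:(u,\mathrm{Reg}_rA)\in\Gamma$, $r:((v,v'),A)\in R$, $v'\neq0$ give $\mathsf{get}(x):(A,\{r\})$. (set) $\Gamma=x:(u,\mathrm{Reg}_rA)\uplus\Gamma'$, $r$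 volatile, $R=r:((v,v'),A)\uplus R'$, $v\neq0$, $R\vdash\Gamma$, $R';\Gamma'\vdash V:(A,\emptyset)$ give $R;\Gamma\vdash\mathsf{set}(x,V):(\mathbf{1},\{r\})$ and, with the same premises, $R;\Gamma\vdash(x\leftarrow V):(\mathbf{B},\emptyset)$. (pset) $\Gamma=x:(u,\mathrm{Reg}_r!A)\uplus\Gamma'$, $r$ persistent, $R=r:((v,v'),!A)\uplus R'$, $v\neq0$, $R\vdash\Gamma$, $R';\Gamma'\vdash V:(!A,\emptyset)$ give $R;\Gamma\vdash\mathsf{pset}(x,V):(\mathbf{1},\{r\})$ and, with the same premises, $R;\Gamma\vdash(x\Leftarrow V):(\mathbf{B},\emptyset)$. (par-store) $R_1;\Gamma_1\vdash P:(\alpha,e)$, $R_2;\Gamma_2\vdash S:(\mathbf{B},\emptyset)$ with $S$ a store give $R_1\uplus R_2;\Gamma_1\uplus\Gamma_2\vdash(P\mid S):(\alpha,e)$, likewise $(S\mid P)$. (par) $R_i;\Gamma_i\vdash P_i:(\alpha_i,e_i)$, $P_i$ not a store ($i=1,2$) give $R_1\uplus R_2;\Gamma_1\uplus\Gamma_2\vdash(P_1\mid P_2):(\mathbf{B},e_1\cup e_2)$. *)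

(* Defs.v *)
From HB Require Import structures.
From Stdlib Require Import List.
From mathcomp Require Import all_boot finmap.
Set Implicit Arguments.
Unset Strict Implicit.
Unset Printing Implicit Defensive.
Local Open Scope fset_scope.

(* Syntax (one raw syntax; categories are carved out by predicates)   *)

Definition var := nat.

Inductive prog : Type :=
| PUnit
| PVar  (x : var)
| PLam  (x : var) (M : prog)
| PBang (M : prog)
| PApp  (M N : prog)
| PLet  (x : var) (M N : prog)       (* let !x = M in N *)
| PNu   (x : var) (P : prog)
| PSet  (x : var) (V : prog)
| PPSet (x : var) (V : prog)
| PGet  (x : var)
| PPar  (P Q : prog)
| PStV  (x : var) (V : prog)         (* (x <- V)  volatile store item   *)
| PStP  (x : var) (V : prog).        (* (x <= V)  persistent store item *)

Fixpoint is_value (P : prog) : Prop :=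
  match P with
  | PUnit | PVar _ => True
  | PLam _ M => is_term M
  | PBang V => is_value V
  | _ => False
  end
with is_term (P : prog) : Prop :=
  match P with
  | PUnit | PVar _ | PGet _ => True
  | PLam _ M | PBang M | PNu _ M => is_term M
  | PApp M N | PLet _ M N | PPar M N => is_term M /\ is_term N
  | PSet _ V | PPSet _ V => is_value V
  | PStV _ _ | PStP _ _ => False
  end.

Fixpoint is_store (P : prog) : Prop :=
  match P with
  | PStV _ V | PStP _ V => is_value V
  | PPar S1 S2 => is_store S1 /\ is_store S2
  | _ => False
  end.

Fixpoint is_prog (P : prog) : Prop :=
  match P with
  | PPar P Q => is_prog P /\ is_prog Q
  | PNu _ P => is_prog P
  | _ => is_term P \/ is_store P
  end.

Fixpoint fv (P : prog) : seq var :=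
  match P with
  | PUnit => [::]
  | PVar x | PGet x => [:: x]
  | PLam x M | PNu x M => [seq y <- fv M | y != x]
  | PBang M => fv M
  | PApp M N | PPar M N => fv M ++ fv N
  | PLet x M N => fv M ++ [seq y <- fv N | y != x]
  | PSet x V | PPSet x V | PStV x V | PStP x V => x :: fv V
  end.

Fixpoint bv (P : prog) : seq var :=
  match P with
  | PUnit | PVar _ | PGet _ => [::]
  | PLam x M | PNu x M => x :: bv M
  | PBang M => bv M
  | PApp M N | PPar M N => bv M ++ bv N
  | PLet x M N => x :: (bv M ++ bv N)
  | PSet _ V | PPSet _ V | PStV _ V | PStP _ V => bv V
  end.

Definition allvars (P : prog) : seq var := fv P ++ bv P.

(* Substitution [V/x]P.  It is the naive (non capture-avoiding)
   substitution; every use of it below is guarded by the side condition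
   that no binder of P is free in V, so it coincides with capture-avoiding
   substitution there.  In the variable positions of set/pset/get/store
   items, x is replaced by z when V is the variable z (the only well-formed
   case). *)
Definition subst_var (V : prog) (x y : var) : var :=
  if y == x then (match V with PVar z => z | _ => y end) else y.

Fixpoint subst (V : prog) (x : var) (P : prog) : prog :=
  match P with
  | PUnit => PUnit
  | PVar y => if y == x then V else PVar y
  | PLam y M => if y == x then PLam y M else PLam y (subst V x M)
  | PBang M => PBang (subst V x M)
  | PApp M N => PApp (subst V x M) (subst V x N)
  | PLet y M N => PLet y (subst V x M) (if y == x then N else subst V x N)
  | PNu y M => if y == x then PNu y M else PNu y (subst V x M)
  | PSet y W => PSet (subst_var V x y) (subst V x W)
  | PPSet y W => PPSet (subst_var V x y) (subst V x W)
  | PGet y => PGet (subst_var V x y)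
  | PPar M N => PPar (subst V x M) (subst V x N)
  | PStV y W => PStV (subst_var V x y) (subst V x W)
  | PStP y W => PStP (subst_var V x y) (subst V x W)
  end.

Definition capture_free (V : prog) (M : prog) : Prop :=
  forall y, y \in bv M -> y \notin fv V.

Definition rename (x y : var) (M : prog) : prog := subst (PVar y) x M.

Inductive alpha : prog -> prog -> Prop :=
| al_refl P : alpha P P
| al_sym P Q : alpha P Q -> alpha Q P
| al_trans P Q T : alpha P Q -> alpha Q T -> alpha P T
| al_lam x y M : y \notin allvars M -> alpha (PLam x M) (PLam y (rename x y M))
| al_let x y M N : y \notin allvars N -> alpha (PLet x M N) (PLet y M (rename x y N))
| al_nu x y M : y \notin allvars M -> alpha (PNu x M) (PNu y (rename x y M))
| al_c_lam x M M' : alpha M M' -> alpha (PLam x M) (PLam x M')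
| al_c_bang M M' : alpha M M' -> alpha (PBang M) (PBang M')
| al_c_appl M M' N : alpha M M' -> alpha (PApp M N) (PApp M' N)
| al_c_appr M N N' : alpha N N' -> alpha (PApp M N) (PApp M N')
| al_c_letl x M M' N : alpha M M' -> alpha (PLet x M N) (PLet x M' N)
| al_c_letr x M N N' : alpha N N' -> alpha (PLet x M N) (PLet x M N')
| al_c_nu x M M' : alpha M M' -> alpha (PNu x M) (PNu x M')
| al_c_set x V V' : alpha V V' -> alpha (PSet x V) (PSet x V')
| al_c_pset x V V' : alpha V V' -> alpha (PPSet x V) (PPSet x V')
| al_c_parl P P' Q : alpha P P' -> alpha (PPar P Q) (PPar P' Q)
| al_c_parr P Q Q' : alpha Q Q' -> alpha (PPar P Q) (PPar P Q')
| al_c_stv x V V' : alpha V V' -> alpha (PStV x V) (PStV x V')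
| al_c_stp x V V' : alpha V V' -> alpha (PStP x V) (PStP x V').

Inductive ectx : Type :=
| EHole
| EAppL (E : ectx) (M : prog)
| EAppR (V : prog) (E : ectx)
| EBang (E : ectx)
| ELet  (x : var) (E : ectx) (M : prog).

Fixpoint fillE (E : ectx) (T : prog) : prog :=
  match E with
  | EHole => T
  | EAppL E M => PApp (fillE E T) M
  | EAppR V E => PApp V (fillE E T)
  | EBang E => PBang (fillE E T)
  | ELet x E M => PLet x (fillE E T) M
  end.

Fixpoint ectx_ok (E : ectx) : Prop :=
  match E with
  | EHole => True
  | EAppL E M => ectx_ok E /\ is_term M
  | EAppR V E => is_value V /\ ectx_ok E
  | EBang E => ectx_ok E
  | ELet _ E M => ectx_ok E /\ is_term M
  end.

Fixpoint fvE (E : ectx) : seq var :=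
  match E with
  | EHole => [::]
  | EAppL E M => fvE E ++ fv M
  | EAppR V E => fv V ++ fvE E
  | EBang E => fvE E
  | ELet x E M => fvE E ++ [seq y <- fv M | y != x]
  end.

Inductive sctx : Type :=
| SHole
| SParL (C : sctx) (P : prog)
| SParR (P : prog) (C : sctx)
| SNu (x : var) (C : sctx).

Fixpoint fillS (C : sctx) (T : prog) : prog :=
  match C with
  | SHole => T
  | SParL C P => PPar (fillS C T) P
  | SParR P C => PPar P (fillS C T)
  | SNu x C => PNu x (fillS C T)
  end.

Inductive sc : prog -> prog -> Prop :=
| sc_refl P : is_prog P -> sc P P
| sc_sym P Q : sc P Q -> sc Q P
| sc_trans P Q T : sc P Q -> sc Q T -> sc P T
| sc_alpha P Q : is_prog P -> alpha P Q -> sc P Q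
| sc_comm P Q : is_prog P -> is_prog Q -> sc (PPar P Q) (PPar Q P)
| sc_assoc P Q T : is_prog P -> is_prog Q -> is_prog T ->
    sc (PPar (PPar P Q) T) (PPar P (PPar Q T))
| sc_extr x P Q : is_prog P -> is_prog Q -> x \notin fv Q ->
    sc (PPar (PNu x P) Q) (PNu x (PPar P Q))
| sc_ectx x E M : ectx_ok E -> is_term M -> x \notin fvE E ->
    sc (fillE E (PNu x M)) (PNu x (fillE E M))
| sc_parl P P' Q : sc P P' -> is_prog Q -> sc (PPar P Q) (PPar P' Q)
| sc_parr P Q Q' : sc Q Q' -> is_prog P -> sc (PPar P Q) (PPar P Q')
| sc_nu x P P' : sc P P' -> sc (PNu x P) (PNu x P').

Inductive basic : prog -> prog -> Prop :=
| b_beta E x M V :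
    ectx_ok E -> is_term M -> is_value V -> capture_free V M ->
    basic (fillE E (PApp (PLam x M) V)) (fillE E (subst V x M))
| b_let E x V M :
    ectx_ok E -> is_term M -> is_value V -> capture_free V M ->
    basic (fillE E (PLet x (PBang V) M)) (fillE E (subst V x M))
| b_set E x V :
    ectx_ok E -> is_value V ->
    basic (fillE E (PSet x V)) (PPar (fillE E PUnit) (PStV x V))
| b_pset E x V :
    ectx_ok E -> is_value V ->
    basic (fillE E (PPSet x V)) (PPar (fillE E PUnit) (PStP x V))
| b_get E x V :
    ectx_ok E -> is_value V ->
    basic (PPar (fillE E (PGet x)) (PStV x V)) (fillE E V)
| b_pget E x V :
    ectx_ok E -> is_value V ->
    basic (PPar (fillE E (PGet x)) (PStP x (PBang V)))
          (PPar (fillE E (PBang V)) (PStP x (PBang V))).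

Definition red (P P' : prog) : Prop :=
  exists C D D', basic D D' /\ sc P (fillS C D) /\ sc P' (fillS C D').

(* a region is a name together with its kind: true = persistent,
   false = volatile *)
Definition region := (nat * bool)%type.
Definition persistent (r : region) : bool := r.2.
Definition volatile (r : region) : bool := ~~ r.2.

Definition effect := {fset region}.

Inductive vty : Type :=
| T1
| TArr (A : vty) (e : effect) (a : ty)
| TBang (A : vty)
| TReg (r : region) (A : vty)
with ty : Type :=
| TB
| TV (A : vty).

Inductive usage := U0 | U1 | Uinf.

Definition usum (a b : usage) : option usage :=
  match a, b with
  | U0, c | c, U0 => Some c
  | Uinf, Uinf => Some Uinf
  | _, _ => None
  end.

Definition rusage := (usage * usage)%type.  (* (output, input) *)

(* which of the three admissible sets a region usage belongs to *)
Definition rclass (U : rusage) : option nat :=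
  match U with
  | (Uinf, Uinf) => Some 1
  | (U1, Uinf) | (U0, Uinf) => Some 2
  | (U0, U0) | (U1, U0) | (U0, U1) | (U1, U1) => Some 3
  | _ => None
  end.

Definition rusage_ok (U : rusage) : Prop := rclass U <> None.

Definition rusum (U V : rusage) : option rusage :=
  match rclass U, rclass V with
  | Some c, Some d =>
      if c == d then
        match usum U.1 V.1, usum U.2 V.2 with
        | Some a, Some b => Some (a, b)
        | _, _ => None
        end
      else None
  | _, _ => None
  end.

Definition rneutral (U : rusage) : Prop :=
  U = (Uinf, Uinf) \/ U = (U0, Uinf) \/ U = (U0, U0).

Definition ctx := seq (var * (usage * vty)).
Definition rctx := seq (region * (rusage * vty)).

Definition dom (G : ctx) : seq var := [seq p.1 | p <- G].
Definition rdom (R : rctx) : seq region := [seq p.1 | p <- R].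

Definition ctx_ok (G : ctx) : Prop :=
  uniq (dom G) /\ forall x u A, In (x, (u, A)) G -> u = U1 \/ u = Uinf.

Definition rctx_ok (R : rctx) : Prop :=
  uniq (rdom R) /\ forall r U A, In (r, (U, A)) R -> rusage_ok U.

Fixpoint lookup (G : ctx) (x : var) : option (usage * vty) :=
  match G with
  | [::] => None
  | (y, uA) :: G => if y == x then Some uA else lookup G x
  end.

Definition entry_sum (o1 o2 o : option (usage * vty)) : Prop :=
  match o1, o2 with
  | None, _ => o = o2
  | _, None => o = o1
  | Some (u1, A1), Some (u2, A2) =>
      exists u, A1 = A2 /\ usum u1 u2 = Some u /\ o = Some (u, A1)
  end.

Definition ctx_sum (G1 G2 G : ctx) : Prop :=
  ctx_ok G1 /\ ctx_ok G2 /\ ctx_ok G /\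
  forall x, entry_sum (lookup G1 x) (lookup G2 x) (lookup G x).

Inductive rext : rctx -> rctx -> Prop :=
| rext_nil : rext [::] [::]
| rext_keep p R R' : rext R R' -> rext (p :: R) (p :: R')
| rext_ins r U A R R' : rneutral U -> rext R R' -> rext R ((r, (U, A)) :: R').

Inductive rzip : rctx -> rctx -> rctx -> Prop :=
| rzip_nil : rzip [::] [::] [::]
| rzip_cons r U1 U2 U A R1 R2 R :
    rusum U1 U2 = Some U -> rzip R1 R2 R ->
    rzip ((r, (U1, A)) :: R1) ((r, (U2, A)) :: R2) ((r, (U, A)) :: R).

Definition rsum (R1 R2 R : rctx) : Prop :=
  rctx_ok R1 /\ rctx_ok R2 /\ rctx_ok R /\
  exists R1' R2', rext R1 R1' /\ rext R2 R2' /\ rzip R1' R2' R.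

Definition sub_dom (e : effect) (R : rctx) : Prop :=
  forall r, r \in e -> r \in rdom R.

Inductive wf_rctx : rctx -> Prop :=
| wf_nil : wf_rctx [::]
| wf_snoc R r U A :
    wf_vty R A -> r \notin rdom R -> rusage_ok U ->
    wf_rctx (rcons R (r, (U, A)))
with wf_vty : rctx -> vty -> Prop :=
| wf_one R : wf_rctx R -> wf_vty R T1
| wf_bang R A : wf_vty R A -> wf_vty R (TBang A)
| wf_arr R A e a : wf_vty R A -> wf_ty R a -> sub_dom e R -> wf_vty R (TArr A e a)
| wf_reg R r U A : wf_rctx R -> In (r, (U, A)) R -> wf_vty R (TReg r A)
with wf_ty : rctx -> ty -> Prop :=
| wf_B R : wf_rctx R -> wf_ty R TB
| wf_V R A : wf_vty R A -> wf_ty R (TV A).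

Definition wf_ctx (R : rctx) (G : ctx) : Prop :=
  ctx_ok G /\ forall x u A, In (x, (u, A)) G -> wf_vty R A.

Inductive sub_vty (R : rctx) : vty -> vty -> Prop :=
| subv_refl A : sub_vty R A A
| subv_bang A A' : sub_vty R A A' -> sub_vty R (TBang A) (TBang A')
| subv_arr A A' e e' a a' :
    e `<=` e' -> sub_dom e' R -> sub_vty R A' A -> sub_ty R a a' ->
    sub_vty R (TArr A e a) (TArr A' e' a')
with sub_ty (R : rctx) : ty -> ty -> Prop :=
| subt_refl a : sub_ty R a a
| subt_V A A' : sub_vty R A A' -> sub_ty R (TV A) (TV A').

Definition aff_r (r : region) (U : rusage) : Prop :=
  U.1 = U1 \/ U.2 = U1 \/ (volatile r /\ U.2 <> U0).

Definition aff (R : rctx) (G : ctx) : Prop :=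
  (exists x A, In (x, (U1, A)) G) \/
  (exists r U A, In (r, (U, A)) R /\ aff_r r U).

Definition saff (R : rctx) (G : ctx) : Prop :=
  (forall x u A, In (x, (u, A)) G -> u = U1) /\
  (forall r U A, In (r, (U, A)) R -> aff_r r U).

Inductive has_type : rctx -> ctx -> prog -> ty -> effect -> Prop :=
| T_sub R G M a e a' e' :
    is_term M -> has_type R G M a e ->
    sub_ty R a a' -> e `<=` e' -> sub_dom e' R ->
    has_type R G M a' e'
| T_var R G x u A :
    wf_ctx R G -> lookup G x = Some (u, A) ->
    has_type R G (PVar x) (TV A) fset0
| T_unit R G :
    wf_ctx R G -> has_type R G PUnit (TV T1) fset0
| T_abs R G x A M a e :
    ctx_ok (rcons G (x, (U1, A))) ->
    has_type R (rcons G (x, (U1, A))) M a e ->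
    has_type R G (PLam x M) (TV (TArr A e a)) fset0
| T_app R1 R2 R G1 G2 G M N A e a e' e'' :
    has_type R1 G1 M (TV (TArr A e a)) e' ->
    has_type R2 G2 N (TV A) e'' ->
    rsum R1 R2 R -> ctx_sum G1 G2 G ->
    has_type R G (PApp M N) a (e `|` e' `|` e'')
| T_prom R R' R0 G G' G0 M A e :
    rsum R R' R0 -> ctx_sum G G' G0 -> wf_ctx R0 G0 ->
    saff R' G' -> has_type R G M (TV A) e -> ~ aff R G ->
    has_type R0 G0 (PBang M) (TV (TBang A)) e
| T_let R1 R2 R G1 G2 G x M N A a e e' :
    has_type R1 G1 M (TV (TBang A)) e ->
    ctx_ok (rcons G2 (x, (Uinf, A))) ->
    has_type R2 (rcons G2 (x, (Uinf, A))) N a e' ->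
    rsum R1 R2 R -> ctx_sum G1 G2 G ->
    has_type R G (PLet x M N) a (e `|` e')
| T_new R G x u r A P a e :
    ctx_ok (rcons G (x, (u, TReg r A))) ->
    has_type R (rcons G (x, (u, TReg r A))) P a e ->
    has_type R G (PNu x P) a e
| T_get R G x u r v v' A :
    wf_ctx R G -> lookup G x = Some (u, TReg r A) ->
    In (r, ((v, v'), A)) R -> v' <> U0 ->
    has_type R G (PGet x) (TV A) [fset r]
| T_set R R' G G' x u r v v' A V :
    ctx_sum [:: (x, (u, TReg r A))] G' G -> volatile r ->
    rsum [:: (r, ((v, v'), A))] R' R -> v <> U0 -> wf_ctx R G ->
    has_type R' G' V (TV A) fset0 ->
    has_type R G (PSet x V) (TV T1) [fset r]
| T_stv R R' G G' x u r v v' A V :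
    ctx_sum [:: (x, (u, TReg r A))] G' G -> volatile r ->
    rsum [:: (r, ((v, v'), A))] R' R -> v <> U0 -> wf_ctx R G ->
    has_type R' G' V (TV A) fset0 ->
    has_type R G (PStV x V) TB fset0
| T_pset R R' G G' x u r v v' A V :
    ctx_sum [:: (x, (u, TReg r (TBang A)))] G' G -> persistent r ->
    rsum [:: (r, ((v, v'), TBang A))] R' R -> v <> U0 -> wf_ctx R G ->
    has_type R' G' V (TV (TBang A)) fset0 ->
    has_type R G (PPSet x V) (TV T1) [fset r]
| T_stp R R' G G' x u r v v' A V :
    ctx_sum [:: (x, (u, TReg r (TBang A)))] G' G -> persistent r ->
    rsum [:: (r, ((v, v'), TBang A))] R' R -> v <> U0 -> wf_ctx R G ->
    has_type R' G' V (TV (TBang A)) fset0 ->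
    has_type R G (PStP x V) TB fset0
| T_par_store_r R1 R2 R G1 G2 G P S a e :
    has_type R1 G1 P a e -> has_type R2 G2 S TB fset0 -> is_store S ->
    rsum R1 R2 R -> ctx_sum G1 G2 G ->
    has_type R G (PPar P S) a e
| T_par_store_l R1 R2 R G1 G2 G P S a e :
    has_type R1 G1 P a e -> has_type R2 G2 S TB fset0 -> is_store S ->
    rsum R1 R2 R -> ctx_sum G1 G2 G ->
    has_type R G (PPar S P) a e
| T_par R1 R2 R G1 G2 G P1 P2 a1 a2 e1 e2 :
    has_type R1 G1 P1 a1 e1 -> has_type R2 G2 P2 a2 e2 ->
    ~ is_store P1 -> ~ is_store P2 ->
    rsum R1 R2 R -> ctx_sum G1 G2 G ->
    has_type R G (PPar P1 P2) TB (e1 `|` e2).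

(* Main.v *)
From Stdlib Require Import List Permutation.
Require Import Defs.
From mathcomp Require Import all_boot finmap.
Set Implicit Arguments.
Unset Strict Implicit.
Unset Printing Implicit Defensive.
Local Open Scope fset_scope.

(* Termination is transferred to an untyped calculus in which addresses are
   erased to their regions and [get] on region [r] may return any value of the
   reducibility candidate of the type of [r]. Stratification makes this
   well-founded: that type only has latent effects on regions declared before
   [r], so the candidates are defined region by region. Reads no longer depend on
   the store, hence the threads of a program reduce independently, and each of
   them terminates by reducibility. A source program and its erasure are related
   up to alpha-renaming and scope extrusion exactly, and up to permutation of
   threads for parallel composition; every source reduction is matched by a
   reduction of exactly one thread, provided that all stored values are
   reducible, which reduction preserves. *)

(** * The erased calculus: de Bruijn syntax and substitution *)

Inductive tm : Type :=
| tunit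
| tvar (n : nat)
| treg (r : region)
| tlam (t : tm)
| tbang (t : tm)
| tapp (t u : tm)
| tlet (t u : tm)
| tset (w v : tm)
| tget (w : tm)
| tpar (t u : tm)
| tst (w v : tm).

Definition upr (xi : nat -> nat) (n : nat) : nat :=
  if n is n'.+1 then (xi n').+1 else 0.

Fixpoint ren (xi : nat -> nat) (t : tm) : tm :=
  match t with
  | tunit => tunit
  | tvar n => tvar (xi n)
  | treg r => treg r
  | tlam t => tlam (ren (upr xi) t)
  | tbang t => tbang (ren xi t)
  | tapp t u => tapp (ren xi t) (ren xi u)
  | tlet t u => tlet (ren xi t) (ren (upr xi) u)
  | tset w v => tset (ren xi w) (ren xi v)
  | tget w => tget (ren xi w)
  | tpar t u => tpar (ren xi t) (ren xi u)
  | tst w v => tst (ren xi w) (ren xi v)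
  end.

Definition up (s : nat -> tm) (n : nat) : tm :=
  if n is n'.+1 then ren S (s n') else tvar 0.

Fixpoint sub (s : nat -> tm) (t : tm) : tm :=
  match t with
  | tunit => tunit
  | tvar n => s n
  | treg r => treg r
  | tlam t => tlam (sub (up s) t)
  | tbang t => tbang (sub s t)
  | tapp t u => tapp (sub s t) (sub s u)
  | tlet t u => tlet (sub s t) (sub (up s) u)
  | tset w v => tset (sub s w) (sub s v)
  | tget w => tget (sub s w)
  | tpar t u => tpar (sub s t) (sub s u)
  | tst w v => tst (sub s w) (sub s v)
  end.

Lemma sub_ext s s' t : s =1 s' -> sub s t = sub s' t.
Proof.
have up_ext (f g : nat -> tm) : f =1 g -> up f =1 up g.
  by move=> h [|n] //=; rewrite h.
elim: t s s' => //= *; f_equal; eauto.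
Qed.

Lemma ren_sub_var xi t : ren xi t = sub (fun n => tvar (xi n)) t.
Proof.
have up_var f : (fun n => tvar (upr f n)) =1 up (fun n => tvar (f n)).
  by case.
elim: t xi => //= [t IH|t IH|t IHt u IHu|t IHt u IHu|w IHw v IHv|w IHw|t IHt u IHu|w IHw v IHv] xi;
  by rewrite ?IH ?IHt ?IHu ?IHw ?IHv //; f_equal; apply: sub_ext.
Qed.

Lemma sub_ren s xi t : sub s (ren xi t) = sub (fun n => s (xi n)) t.
Proof.
have up_upr f g : (fun n => up f (upr g n)) =1 up (fun n => f (g n)).
  by case.
elim: t s xi => //= [t IH|t IH|t IHt u IHu|t IHt u IHu|w IHw v IHv|w IHw|t IHt u IHu|w IHw v IHv] s xi;
  by rewrite ?IH ?IHt ?IHu ?IHw ?IHv //; f_equal; apply: sub_ext.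
Qed.

Lemma ren_sub s xi t : ren xi (sub s t) = sub (fun n => ren xi (s n)) t.
Proof.
have upr_up f g : (fun n => ren (upr g) (up f n)) =1 up (fun n => ren g (f n)).
  by case=> //= n; rewrite (ren_sub_var (upr g)) (ren_sub_var S (ren _ _)) !sub_ren.
elim: t s xi => //= [t IH|t IH|t IHt u IHu|t IHt u IHu|w IHw v IHv|w IHw|t IHt u IHu|w IHw v IHv] s xi;
  by rewrite ?IH ?IHt ?IHu ?IHw ?IHv //; f_equal; apply: sub_ext.
Qed.

Lemma sub_up_shift s t : sub (up s) (ren S t) = ren S (sub s t).
Proof. by rewrite sub_ren ren_sub. Qed.

Lemma sub_sub s s' t : sub s' (sub s t) = sub (fun n => sub s' (s n)) t.
Proof.
have up_up f g : (fun n => sub (up g) (up f n)) =1 up (fun n => sub g (f n)).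
  by case=> //= n; rewrite sub_up_shift.
elim: t s s' => //= [t IH|t IH|t IHt u IHu|t IHt u IHu|w IHw v IHv|w IHw|t IHt u IHu|w IHw v IHv] s s';
  by rewrite ?IH ?IHt ?IHu ?IHw ?IHv //; f_equal; apply: sub_ext.
Qed.

Lemma sub_id t : sub tvar t = t.
Proof.
have up_id : up tvar =1 tvar by case.
have {}up_id u : sub tvar u = u -> sub (up tvar) u = u.
  by move=> h; rewrite -[RHS]h; apply: sub_ext.
by elim: t => //= *; f_equal; auto.
Qed.

Definition inst (v : tm) (n : nat) : tm := if n is n'.+1 then tvar n' else v.

Lemma sub_inst_shift v t : sub (inst v) (ren S t) = t.
Proof. by rewrite sub_ren -[RHS]sub_id; apply: sub_ext. Qed.

(** * Values and labelled reduction of the erased calculus *)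

Fixpoint tval (t : tm) : Prop :=
  match t with
  | tunit | tvar _ | treg _ | tlam _ => True
  | tbang t => tval t
  | _ => False
  end.

Inductive label := Ltau | Lrd (w v : tm) | Lwr (w v : tm).

(** The store stays outside: a write shows only in the label, and a read returns an arbitrary [v],
    restricted later by a condition on the label. There is no rule for [tpar], whose sides run as
    separate threads. *)
Inductive lstep : tm -> label -> tm -> Prop :=
| ls_beta b v : tval v -> lstep (tapp (tlam b) v) Ltau (sub (inst v) b)
| ls_let v n : tval v -> lstep (tlet (tbang v) n) Ltau (sub (inst v) n)
| ls_set w v : lstep (tset w v) (Lwr w v) tunit
| ls_get w v : lstep (tget w) (Lrd w v) v
| ls_appl t l t' u : lstep t l t' -> lstep (tapp t u) l (tapp t' u)
| ls_appr v t l t' : tval v -> lstep t l t' -> lstep (tapp v t) l (tapp v t')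
| ls_bang t l t' : lstep t l t' -> lstep (tbang t) l (tbang t')
| ls_letl t l t' n : lstep t l t' -> lstep (tlet t n) l (tlet t' n).

Lemma tval_lstep t l t' : lstep t l t' -> tval t -> False.
Proof. by elim. Qed.

(** * Reducibility candidates over given sets of readable values *)

Section Reducibility.

Variable Phi : region -> tm -> Prop.

(** A rely-guarantee pair: [lsafe] is what a term owes to its environment, [lok] what it may assume
    in return. Both meet in [Phi], so safe writes keep later reads harmless. *)
Definition lsafe (e : region -> Prop) (l : label) : Prop :=
  match l with
  | Ltau => True
  | Lrd w _ => exists2 r, w = treg r & e r
  | Lwr w v => exists2 r, w = treg r & e r /\ Phi r v
  end.

Definition lok (l : label) : Prop :=
  if l is Lrd w v then exists2 r, w = treg r & Phi r v else True.

(** Being inductive, a derivation proves termination of all runs whose reads obey [lok]. A stuck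
    sequential term qualifies vacuously. A [tpar] yields no value, so its two sides are only asked
    to be reducible without postcondition. *)
Inductive Red (e : region -> Prop) : (tm -> Prop) -> tm -> Prop :=
| Red_val Q v : tval v -> Q v -> Red e Q v
| Red_step Q t :
    ~ tval t ->
    (forall w v, t <> tst w v) ->
    (forall l t', lstep t l t' -> lsafe e l) ->
    (forall l t', lstep t l t' -> lok l -> Red e Q t') ->
    (forall a b, t = tpar a b -> Red e (fun _ => True) a) ->
    (forall a b, t = tpar a b -> Red e (fun _ => True) b) ->
    Red e Q t.

(** A latent effect refers to the types of other regions, but only through [Phi]; this keeps the
    recursion structural. *)
Fixpoint RED (A : vty) : tm -> Prop :=
  match A with
  | T1 => tval
  | TReg r _ => fun t => t = treg r
  | TBang A => fun t => exists2 v, t = tbang v & RED A v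
  | TArr A e a => fun t => tval t /\
      forall v, RED A v -> Red (fun r => r \in e) (REDty a) (tapp t v)
  end
with REDty (a : ty) : tm -> Prop :=
  match a with
  | TB => fun _ => True
  | TV A => RED A
  end.

Lemma RED_tval A t : RED A t -> tval t.
Proof. by elim: A t => [|A _ e a|A IH|r A _] t /= => [|[]|[v -> /IH]|->]. Qed.

Lemma Red_tval e Q v : Red e Q v -> tval v -> Q v.
Proof. by case. Qed.

(** [F] is an evaluation frame: while its hole is not a value, all its steps come from the hole.
    Induction on the derivation for [m] leaves only the case of values. *)
Lemma Red_bind (F : tm -> tm) e e' Q Q' m :
  (forall t, tval (F t) -> tval t) ->
  (forall t w v, F t <> tst w v) ->
  (forall t a b, F t <> tpar a b) ->
  (forall t l t', ~ tval t -> lstep (F t) l t' ->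
     exists2 t1, t' = F t1 & lstep t l t1) ->
  (forall r, e r -> e' r) ->
  (forall v, tval v -> Q v -> Red e' Q' (F v)) ->
  Red e Q m -> Red e' Q' (F m).
Proof.
move=> Fval Fst Fpar Fstep ee' HF Hm.
elim: Hm HF => {}Q {}m hv; first by move=> hQ; apply.
move=> _ hsafe hstep IH _ _ _ _ HF.
apply: Red_step => [/Fval //|//|l t' /Fstep|l t' /Fstep|a b /Fpar //|a b /Fpar //].
- case=> // t1 _ /hsafe; case: l => //= w v [r] -> => [/ee'|[/ee']]; by exists r.
- by case=> // t1 -> /IH h /h; apply.
Qed.

Lemma Red_bang e Q (Q' : tm -> Prop) m :
  (forall v, Q v -> Q' (tbang v)) -> Red e Q m -> Red e Q' (tbang m).
Proof.
move=> QQ'; apply: Red_bind => //; last first.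
- by move=> v hv /QQ'; apply: Red_val.
- by move=> t l t' tv h; inversion h; subst; eexists; eauto.
Qed.

Lemma Red_app e1 e2 e' Q1 Q2 Q' m n :
  (forall r, e1 r -> e' r) -> (forall r, e2 r -> e' r) ->
  Red e1 Q1 m -> Red e2 Q2 n ->
  (forall v1 v2, tval v1 -> tval v2 -> Q1 v1 -> Q2 v2 -> Red e' Q' (tapp v1 v2)) ->
  Red e' Q' (tapp m n).
Proof.
move=> h1 h2 Hm Hn H.
apply: (Red_bind (F := fun t => tapp t n)) Hm => //.
- move=> t l t' tv h; inversion h; subst; by [case: tv|eexists; eauto].
move=> v1 vv1 Qv1.
apply: (Red_bind (F := fun t => tapp v1 t)) Hn => //; last by auto.
move=> t l t' tv h; inversion h; subst; try by [case: tv|eexists; eauto].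
by case: (tval_lstep (ltac:(eassumption))).
Qed.

Lemma Red_let e1 e' Q1 Q' m n :
  (forall r, e1 r -> e' r) ->
  Red e1 Q1 m ->
  (forall v, tval v -> Q1 v -> Red e' Q' (tlet v n)) ->
  Red e' Q' (tlet m n).
Proof.
move=> h1 Hm H.
apply: (Red_bind (F := fun t => tlet t n)) Hm => //.
by move=> t l t' tv h; inversion h; subst; by [case: tv|eexists; eauto].
Qed.

Definition atom (t : tm) : Prop :=
  match t with tpar _ _ | tst _ _ => False | _ => True end.

Lemma Red_tau e Q t t0 :
  ~ tval t -> atom t -> (forall l t', lstep t l t' -> l = Ltau /\ t' = t0) ->
  Red e Q t0 -> Red e Q t.
Proof.
move=> tv ta ht h0; apply: Red_step => //; try by case: t ta {tv ht}.
- by move=> l t' /ht [-> _].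
- by move=> l t' /ht [_ ->].
Qed.

Lemma Red_beta e Q b v :
  tval v -> Red e Q (sub (inst v) b) -> Red e Q (tapp (tlam b) v).
Proof.
move=> vv; apply: Red_tau => // l t' h.
inversion h; subst=> //; by case: (tval_lstep (ltac:(eassumption))); auto.
Qed.

Lemma Red_letbang e Q n v :
  tval v -> Red e Q (sub (inst v) n) -> Red e Q (tlet (tbang v) n).
Proof.
move=> vv; apply: Red_tau => // l t' h.
inversion h; subst=> //; by case: (tval_lstep (ltac:(eassumption))); auto.
Qed.

Lemma Red_stuck e Q t :
  ~ tval t -> atom t -> (forall l t', ~ lstep t l t') -> Red e Q t.
Proof.
move=> tv ta ht; apply: Red_step => //; try by case: t ta {tv ht}.
- by move=> l t' /ht.
- by move=> l t' /ht.
Qed.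

(** An inhabitant of each candidate, used to close open programs. The body [tapp tunit tunit] is
    stuck, hence reducible at every result type. *)
Fixpoint dflt (A : vty) : tm :=
  match A with
  | T1 => tunit
  | TReg r _ => treg r
  | TBang A => tbang (dflt A)
  | TArr _ _ _ => tlam (tapp tunit tunit)
  end.

Lemma RED_dflt A : RED A (dflt A).
Proof.
elim: A => //= [A _ e a|A IH]; last by exists (dflt A).
split=> // v hv; apply: Red_beta; first exact: RED_tval hv.
apply: Red_stuck => // l t' h; inversion h; subst;
  by case: (tval_lstep (ltac:(eassumption))); auto.
Qed.

End Reducibility.

(** Agreement of [Phi] and [Phi'] on [e] suffices: safety confines all reads and writes of [t] to
    [e], so a value read under [Phi'] is also admissible under [Phi]. *)
Lemma Red_mono (Phi Phi' : region -> tm -> Prop) (e e' : region -> Prop)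
    (Q Q' : tm -> Prop) t :
  (forall r, e r -> e' r) ->
  (forall r v, e r -> Phi r v <-> Phi' r v) ->
  (forall v, Q v -> Q' v) ->
  Red Phi e Q t -> Red Phi' e' Q' t.
Proof.
move=> ee' PP' QQ' Ht; elim: Ht Q' QQ' => {}Q {}t hv; first by move=> hQ Q' QQ'; apply: Red_val; auto.
move=> hst hsafe hstep IH _ IHa _ IHb Q' QQ'.
apply: Red_step => //.
- move=> l t' /hsafe; case: l => //= w v [r ->].
    by move=> /ee'; exists r.
  by case=> er /(PP' _ _ er); exists r; auto.
- move=> l t' h ok; apply: IH (h) _ _ QQ'.
  have := hsafe _ _ h; case: l {h} ok => //= w v [r wr pr] [r' wr' er'].
  by move: wr' pr; rewrite wr => -[->] /(PP' _ _ er'); exists r'.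
- by move=> a b /IHa; apply.
- by move=> a b /IHb; apply.
Qed.

(** * Dependence of candidates on latent effects, and subtyping *)

Fixpoint effs (A : vty) (r : region) : Prop :=
  match A with
  | T1 | TReg _ _ => False
  | TBang A => effs A r
  | TArr A e a => effs A r \/ r \in e \/ effs_ty a r
  end
with effs_ty (a : ty) (r : region) : Prop :=
  match a with
  | TB => False
  | TV A => effs A r
  end.

Scheme vty_mind := Induction for vty Sort Prop
  with ty_mind := Induction for ty Sort Prop.

(** [Phi] enters a candidate only through [Red] at arrow types, where [Red_mono] asks for agreement
    on the latent effect alone. *)
Lemma RED_agree (Phi Phi' : region -> tm -> Prop) A :
  (forall r v, effs A r -> Phi r v <-> Phi' r v) ->
  forall t, RED Phi A t <-> RED Phi' A t.
Proof.
move: A.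
apply: (@vty_mind (fun A => (forall r v, effs A r -> Phi r v <-> Phi' r v) ->
    forall t, RED Phi A t <-> RED Phi' A t)
  (fun a => (forall r v, effs_ty a r -> Phi r v <-> Phi' r v) ->
    forall t, REDty Phi a t <-> REDty Phi' a t)) => //=.
- move=> A IHA e a IHa H t.
  have {}IHA := IHA (fun r v h => H r v (or_introl h)).
  have {}IHa := IHa (fun r v h => H r v (or_intror (or_intror h))).
  have {}H r v (h : r \in e) := H r v (or_intror (or_introl h)).
  split=> -[tv h]; split=> // v /IHA /h; apply: Red_mono => //.
  + by move=> u /IHa.
  + by move=> r u re; split=> /(H _ _ re).
  + by move=> u /IHa.
- by move=> A IH H t; split=> -[v -> /(IH H)]; exists v.
Qed.

Scheme subv_mind := Induction for sub_vty Sort Prop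
  with subt_mind := Induction for sub_ty Sort Prop.

Lemma REDty_sub (Phi : region -> tm -> Prop) R a a' :
  sub_ty R a a' -> forall t, REDty Phi a t -> REDty Phi a' t.
Proof.
move: a a'.
apply: (@subt_mind R
  (fun A A' _ => forall t, RED Phi A t -> RED Phi A' t)
  (fun a a' _ => forall t, REDty Phi a t -> REDty Phi a' t)) => //=.
- by move=> A A' _ IH t [v -> /IH]; exists v.
- move=> A A' e e' a a' /fsubsetP ee' _ _ IHA _ IHa t [tv h]; split=> // v /IHA /h.
  by apply: Red_mono.
Qed.

(** * Region contexts and the stratified interpretation *)

Inductive emb : rctx -> rctx -> Prop :=
| emb_nil R : emb [::] R
| emb_cons r U U' A R R' : emb R R' -> emb ((r, (U, A)) :: R) ((r, (U', A)) :: R')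
| emb_skip p R R' : emb R R' -> emb R (p :: R').

Lemma emb_refl R : emb R R.
Proof. by elim: R => [|[r [U A]] R IH]; constructor. Qed.

Lemma emb_trans R1 R2 R3 : emb R1 R2 -> emb R2 R3 -> emb R1 R3.
Proof.
move=> h12 h23; elim: h23 R1 h12 => [R|r U U' A R R' _ IH|p R R' _ IH] R1 h.
- by inversion h; constructor.
- inversion h; subst; by constructor; auto.
- by constructor; auto.
Qed.

Lemma emb_rdom R R' : emb R R' -> {subset rdom R <= rdom R'}.
Proof.
elim=> [{}R|r U U' A {}R {}R' _ IH|p {}R {}R' _ IH] //= s.
- by rewrite !inE => /orP[->//|/IH ->]; rewrite orbT.
- by rewrite inE => /IH ->; rewrite orbT.
Qed.

(** Embeddings keep the order, so regions declared before [r] stay before [r]; this carries bounds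
    on latent effects to a larger region context. *)
Lemma emb_split R1 r U A R2 R' : emb (R1 ++ (r, (U, A)) :: R2) R' ->
  exists R1' U' R2', R' = R1' ++ (r, (U', A)) :: R2' /\ emb R1 R1'.
Proof.
move E: (R1 ++ _) => R h; elim: h R1 E => [{}R|s V V' B {}R {}R' h IH|p {}R {}R' _ IH] R1.
- by case: R1.
- case: R1 => [|q R1] /= [].
    by case=> -> _ -> _; exists [::], V', R'; split=> //; constructor.
  move=> -> /IH [R1' [U' [R2' [-> h']]]].
  by exists ((s, (V', B)) :: R1'), U', R2'; split=> //; constructor.
- move=> /IH [R1' [U' [R2' [-> h']]]].
  by exists (p :: R1'), U', R2'; split=> //; constructor.
Qed.

(** Equalizing domains only inserts regions and adding usages changes no type. Hence the premises of
    a typing rule live in region contexts embedded in that of the conclusion. *)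
Lemma rsum_emb R1 R2 R : rsum R1 R2 R -> emb R1 R /\ emb R2 R.
Proof.
have rext_emb S S' : rext S S' -> emb S S'.
  elim=> [|[r [U A]] {}S {}S' _ IH|r U A {}S {}S' _ _ IH]; by constructor.
move=> [_ [_ [_ [R1' [R2' [/rext_emb h1 [/rext_emb h2 hz]]]]]]].
have [z1 z2] : emb R1' R /\ emb R2' R.
  elim: hz {h1 h2} => [|r U1 U2 U A S1 S2 S _ _ [IH1 IH2]]; by split; constructor.
by split; apply: emb_trans; eauto.
Qed.

Scheme wfv_mind := Induction for wf_vty Sort Prop
  with wft_mind := Induction for wf_ty Sort Prop.

Lemma wf_vty_effs R A r : wf_vty R A -> effs A r -> r \in rdom R.
Proof.
move=> h; move: R A h.
apply: (@wfv_mind (fun R A _ => effs A r -> r \in rdom R)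
                  (fun R a _ => effs_ty a r -> r \in rdom R)) => //=.
by move=> R A e a _ IHA _ IHa ed [/IHA|[/ed|/IHa]].
Qed.

Lemma wf_vty_rctx R A : wf_vty R A -> wf_rctx R.
Proof. by elim. Qed.

(** Stratification at work: [A] was formed before [r] was appended, so its latent effects lie in the
    prefix [R1]. *)
Lemma wf_rctx_effs R r U A : wf_rctx R -> In (r, (U, A)) R ->
  exists R1 R2, R = R1 ++ (r, (U, A)) :: R2 /\
    forall s, effs A s -> s \in rdom R1.
Proof.
elim/last_ind: R => [|R [s [V B]] IH] //= h.
inversion h as [h0|R0 s' V' B' hB hs hV E]; first by case: (R) h0.
have {E} [? [? ? ?]] := rcons_inj E; subst.
rewrite -cats1 => /in_app_iff [/(IH (wf_vty_rctx hB))|[[<- <- <-]|//]].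
- move=> [R1 [R2 [-> hR1]]]; exists R1, (rcons R2 (s, (V, B))).
  by rewrite -cats1 -catA /= cats1.
- by exists R, [::]; split=> // t; apply: wf_vty_effs.
Qed.

(* The set of values readable from a region is fixed by recursion on the
   stratification: the candidate of its type only consults the regions
   declared before it, which come later in the reversed list. *)
Fixpoint readable (R : rctx) : region -> tm -> Prop :=
  match R with
  | [::] => fun _ _ => False
  | (r, (_, A)) :: R' => fun s =>
      if s == r then RED (readable R') A else readable R' s
  end.

(** The fixed-point equation tying reads to candidates. It ranges over all well-formed embedded
    contexts because a typing derivation splits [R] and each premise sees its own part. *)
Definition saturated (Phi : region -> tm -> Prop) (R : rctx) : Prop :=
  forall R' r U A, emb R' R -> wf_rctx R' -> In (r, (U, A)) R' ->
  forall v, Phi r v <-> RED Phi A v.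

Lemma saturated_emb Phi R R' : emb R' R -> saturated Phi R -> saturated Phi R'.
Proof. by move=> h H S r U A hS; apply: H; apply: emb_trans h. Qed.

Lemma readable_cat R1 R2 r v : r \notin rdom R1 ->
  readable (R1 ++ R2) r v <-> readable R2 r v.
Proof.
elim: R1 => [|[s [U A]] R1 IH] //=; rewrite inE negb_or => /andP[/negbTE -> /IH ->].
by [].
Qed.

(** In the reversed list the entry of [r] is followed exactly by the regions declared before it.
    These contain all latent effects of [A], so the candidates over this tail and over the whole
    list agree. *)
Lemma saturated_readable R : uniq (rdom R) -> saturated (readable (rev R)) R.
Proof.
move=> uR R' r U A hemb wfR' /(wf_rctx_effs wfR') [S1 [S2 [ES hS]]] v.
rewrite {}ES in hemb; have {hemb}[R1 [U' [R2 [ER h1]]]] := emb_split hemb.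
move: uR; rewrite {}ER /rdom map_cat /= cat_uniq /= => /and4P[_].
rewrite negb_or => /andP[rR1 /hasPn dR] rR2 _.
have ER : rev (R1 ++ (r, (U', A)) :: R2) = rev R2 ++ (r, (U', A)) :: rev R1.
  by rewrite rev_cat rev_cons cat_rcons.
have rdr (S : rctx) s : (s \in rdom (rev S)) = (s \in rdom S).
  by rewrite /rdom map_rev mem_rev.
rewrite ER readable_cat ?rdr //= eqxx.
apply: RED_agree => s u /hS /(emb_rdom h1) sR1.
(* Regions are distinct, so looking up [s] in the whole list skips [R2] and [r] and lands in [R1],
   as it does in the tail. *)
have sR2 : s \notin rdom R2 by apply: contraL sR1 => /dR.
rewrite readable_cat ?rdr //=; case: eqP => // E.
by rewrite E in sR1; rewrite sR1 in rR1.
Qed.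

(** * The erasure relation and its stability under substitution *)

Definition upd (rho : var -> tm) (x : var) (v : tm) (y : var) : tm :=
  if y == x then v else rho y.

Definition ext (rho : var -> tm) (x : var) (y : var) : tm :=
  if y == x then tvar 0 else ren S (rho y).

Definition junk (w : tm) : Prop :=
  match w with tvar _ | treg _ => False | _ => True end.

(* [subst] leaves an address position untouched when the substituted value is
   not a variable, whereas [sub] puts that value there. Such ill-typed
   positions are related to anything; typing keeps them out of redexes. *)
Definition addr (rho : var -> tm) (x : var) (w : tm) : Prop :=
  w = rho x \/ junk w.

(* [tr rho P t]: [t] is obtained from [P] by replacing free variables along
   [rho] and each [nu]-bound address by some region constant. *)
Fixpoint tr (rho : var -> tm) (P : prog) (t : tm) : Prop :=
  match P with
  | PUnit => t = tunit
  | PVar x => t = rho x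
  | PLam x M => exists2 m, t = tlam m & tr (ext rho x) M m
  | PBang M => exists2 m, t = tbang m & tr rho M m
  | PApp M N => exists m n, [/\ t = tapp m n, tr rho M m & tr rho N n]
  | PLet x M N => exists m n, [/\ t = tlet m n, tr rho M m & tr (ext rho x) N n]
  | PNu x P => exists r, tr (upd rho x (treg r)) P t
  | PSet x V | PPSet x V =>
      exists w v, [/\ t = tset w v, addr rho x w & tr rho V v]
  | PGet x => exists2 w, t = tget w & addr rho x w
  | PPar P Q => exists m n, [/\ t = tpar m n, tr rho P m & tr rho Q n]
  | PStV x V | PStP x V =>
      exists w v, [/\ t = tst w v, addr rho x w & tr rho V v]
  end.

Lemma tr_ext rho rho' P t :
  (forall x, x \in fv P -> rho x = rho' x) -> tr rho P t -> tr rho' P t.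
Proof.
have ext_eq (f g : var -> tm) x s :
    {in [seq y <- s | y != x], f =1 g} -> {in s, ext f x =1 ext g x}.
  by move=> h y ys; rewrite /ext; case: eqP => // /eqP yx; rewrite h // mem_filter yx.
have upd_eq (f g : var -> tm) x v s :
    {in [seq y <- s | y != x], f =1 g} -> {in s, upd f x v =1 upd g x v}.
  by move=> h y ys; rewrite /upd; case: eqP => // /eqP yx; rewrite h // mem_filter yx.
have addr_eq (f g : var -> tm) x w : f x = g x -> addr f x w -> addr g x w.
  by rewrite /addr => ->.
elim: P rho rho' t => [|x|x M IH|M IH|M IHM N IHN|x M IHM N IHN|x M IH|x V IH|x V IH|x|M IHM N IHN|x V IH|x V IH] rho rho' t /= H //.
- by rewrite H // inE.
- by move=> [m -> /IH h]; exists m => //; apply: h; apply: ext_eq.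
- by move=> [m -> /IH h]; exists m => //; apply: h.
- move=> [m [n [-> /IHM hm /IHN hn]]]; exists m, n; split=> //.
  + by apply: hm => y hy; apply: H; rewrite mem_cat hy.
  + by apply: hn => y hy; apply: H; rewrite mem_cat hy orbT.
- move=> [m [n [-> /IHM hm /IHN hn]]]; exists m, n; split=> //.
  + by apply: hm => y hy; apply: H; rewrite mem_cat hy.
  + by apply: hn; apply: ext_eq => y hy; apply: H; rewrite mem_cat hy orbT.
- by move=> [r /IH h]; exists r; apply: h; apply: upd_eq.
- move=> [w [v [-> /addr_eq hw /IH hv]]]; exists w, v; split=> //.
  + by apply: hw; apply: H; rewrite inE eqxx.
  + by apply: hv => y hy; apply: H; rewrite inE hy orbT.
- move=> [w [v [-> /addr_eq hw /IH hv]]]; exists w, v; split=> //.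
  + by apply: hw; apply: H; rewrite inE eqxx.
  + by apply: hv => y hy; apply: H; rewrite inE hy orbT.
- by move=> [w -> /addr_eq hw]; exists w => //; apply: hw; apply: H; rewrite inE.
- move=> [m [n [-> /IHM hm /IHN hn]]]; exists m, n; split=> //.
  + by apply: hm => y hy; apply: H; rewrite mem_cat hy.
  + by apply: hn => y hy; apply: H; rewrite mem_cat hy orbT.
- move=> [w [v [-> /addr_eq hw /IH hv]]]; exists w, v; split=> //.
  + by apply: hw; apply: H; rewrite inE eqxx.
  + by apply: hv => y hy; apply: H; rewrite inE hy orbT.
- move=> [w [v [-> /addr_eq hw /IH hv]]]; exists w, v; split=> //.
  + by apply: hw; apply: H; rewrite inE eqxx.
  + by apply: hv => y hy; apply: H; rewrite inE hy orbT.
Qed.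

Lemma tr_eq1 rho rho' P t : rho =1 rho' -> tr rho P t -> tr rho' P t.
Proof. by move=> h; apply: tr_ext => x _. Qed.

Lemma tr_upd_fresh rho x v P t : x \notin fv P ->
  tr (upd rho x v) P t <-> tr rho P t.
Proof.
by move=> xP; split; apply: tr_ext => y yP; rewrite /upd;
  case: eqP => // yx; rewrite -yx yP in xP.
Qed.

(** Substitution acts on the environment alone: region constants are closed, and junk stays junk
    under [s]. *)
Lemma tr_sub rho s P t : tr rho P t -> tr (fun y => sub s (rho y)) P (sub s t).
Proof.
have addr_sub (f : var -> tm) u x w :
    addr f x w -> addr (fun y => sub u (f y)) x (sub u w).
  by move=> [->|jw]; [left|right; case: w jw].
have extE f u x : (fun y => sub (up u) (ext f x y)) =1 ext (fun y => sub u (f y)) x.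
  by move=> y; rewrite /ext; case: eqP => //= _; rewrite sub_up_shift.
have updE f u x r : (fun y => sub u (upd f x (treg r) y))
    =1 upd (fun y => sub u (f y)) x (treg r).
  by move=> y; rewrite /upd; case: eqP.
elim: P rho s t => [|x|x M IH|M IH|M IHM N IHN|x M IHM N IHN|x M IH|x V IH|x V IH|x|M IHM N IHN|x V IH|x V IH] rho s t /=.
- by move->.
- by move->.
- by move=> [m -> /(IH _ (up s)) /(tr_eq1 (extE _ _ _)) h]; exists (sub (up s) m).
- by move=> [m -> /(IH _ s) h]; exists (sub s m).
- by move=> [m [n [-> /(IHM _ s) hm /(IHN _ s) hn]]]; exists (sub s m), (sub s n).
- move=> [m [n [-> /(IHM _ s) hm /(IHN _ (up s)) /(tr_eq1 (extE _ _ _)) hn]]].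
  by exists (sub s m), (sub (up s) n).
- by move=> [r /(IH _ s) /(tr_eq1 (updE _ _ _ _)) h]; exists r.
- by move=> [w [v [-> /(addr_sub _ s) hw /(IH _ s) hv]]]; exists (sub s w), (sub s v).
- by move=> [w [v [-> /(addr_sub _ s) hw /(IH _ s) hv]]]; exists (sub s w), (sub s v).
- by move=> [w -> /(addr_sub _ s) hw]; exists (sub s w).
- by move=> [m [n [-> /(IHM _ s) hm /(IHN _ s) hn]]]; exists (sub s m), (sub s n).
- by move=> [w [v [-> /(addr_sub _ s) hw /(IH _ s) hv]]]; exists (sub s w), (sub s v).
- by move=> [w [v [-> /(addr_sub _ s) hw /(IH _ s) hv]]]; exists (sub s w), (sub s v).
Qed.

Lemma tr_val rho V t :
  is_value V -> (forall x, tval (rho x)) -> tr rho V t -> tval t.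
Proof.
move=> hV hr; elim: V hV t => //= [_ t ->|x _ t ->|x M _ _ t [m ->]|M IH hM t [m -> /IH]] //.
exact.
Qed.

Lemma ext_upd rho x v y : y != x ->
  ext (upd rho x v) y =1 upd (ext rho y) x (ren S v).
Proof.
move=> yx z; rewrite /ext /upd; case: (z =P y) => [->|//].
  by rewrite (negbTE yx).
by case: (z =P x).
Qed.

Lemma ext_upd_same rho x v : ext (upd rho x v) x =1 ext rho x.
Proof. by move=> z; rewrite /ext /upd; case: (z =P x). Qed.

Lemma upd_upd rho x v y w : y != x ->
  upd (upd rho x v) y w =1 upd (upd rho y w) x v.
Proof.
move=> yx z; rewrite /upd; case: (z =P y) => [->|//].
by rewrite (negbTE yx).
Qed.

Lemma upd_upd_same rho x v w : upd (upd rho x v) x w =1 upd rho x w.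
Proof. by move=> z; rewrite /upd; case: (z =P x). Qed.

Lemma tr_ext_fresh rho V v y : y \notin fv V -> tr rho V v ->
  tr (ext rho y) V (ren S v).
Proof.
move=> yV /(tr_sub (fun n => tvar n.+1)); rewrite -ren_sub_var.
apply: tr_ext => z zV; rewrite /ext -ren_sub_var.
by case: eqP => // zy; rewrite -zy zV in yV.
Qed.

(** If [V] is a variable, both substitutions rename the address. Any other value erases to junk,
    which is related to the address that [subst_var] leaves in place. *)
Lemma addr_subst rho x V v y w : is_value V -> tr rho V v ->
  addr (upd rho x v) y w -> addr rho (subst_var V x y) w.
Proof.
rewrite /addr /upd /subst_var; case: eqP => //= _ hV; case: V hV => //=.
- by move=> _ -> [->|]; right.
- by move=> z _ ->.
- by move=> z M _ [m -> _] [->|]; right.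
- by move=> M _ [m -> _] [->|]; right.
Qed.

(** Capture-freeness keeps every binder of [P] out of [V], so [v] is merely shifted or kept below
    it; a binder equal to [x] overrides the update. *)
Lemma tr_subst rho x V v P t :
  is_value V -> capture_free V P -> tr rho V v ->
  tr (upd rho x v) P t -> tr rho (subst V x P) t.
Proof.
move=> hV.
have cfl s1 s2 (h : forall y, y \in s1 ++ s2 -> y \notin fv V) :
    (forall y, y \in s1 -> y \notin fv V) /\ (forall y, y \in s2 -> y \notin fv V).
  by split=> y hy; apply: h; rewrite mem_cat hy ?orbT.
have cfc z s (h : forall y, y \in z :: s -> y \notin fv V) :
    z \notin fv V /\ (forall y, y \in s -> y \notin fv V).
  by split=> [|y hy]; apply: h; rewrite inE ?eqxx ?hy ?orbT.
rewrite /capture_free.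
elim: P rho v t => [|y|y M IH|M IH|M IHM N IHN|y M IHM N IHN|y M IH|y W IH|y W IH|y|M IHM N IHN|y W IH|y W IH] rho v t /= H hv //.
- by rewrite /upd; case: eqP => // _ ->.
- move=> [m -> hm]; have [yV H'] := cfc _ _ H.
  case: ifPn => [/eqP E|yx] /=; exists m => //.
    by move: hm; rewrite E; apply/tr_eq1/ext_upd_same.
  apply: IH H' (tr_ext_fresh yV hv) _.
  by move: hm; apply/tr_eq1/ext_upd.
- by move=> [m -> hm]; exists m => //; apply: IH hm.
- move=> [m [n [-> hm hn]]]; have [H1 H2] := cfl _ _ H.
  by exists m, n; split=> //; [apply: IHM hm|apply: IHN hn].
- move=> [m [n [-> hm hn]]]; have [yV H'] := cfc _ _ H.
  have [H1 H2] := cfl _ _ H'.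
  exists m, n; split=> //; first exact: IHM hm.
  move: hn; case: ifPn => [/eqP ->|yx hn]; first exact/tr_eq1/ext_upd_same.
  apply: IHN H2 (tr_ext_fresh yV hv) _.
  by move: hn; apply/tr_eq1/ext_upd.
- move=> [r hm]; have [yV H'] := cfc _ _ H.
  case: ifPn => [/eqP E|yx] /=; exists r.
    by move: hm; rewrite E; apply/tr_eq1/upd_upd_same.
  apply: (IH _ v) H' _ _; first by apply/tr_upd_fresh.
  by move: hm; apply/tr_eq1/upd_upd.
- move=> [w [u [-> hw hu]]]; exists w, u; split=> //; last exact: IH hu.
  exact: addr_subst hw.
- move=> [w [u [-> hw hu]]]; exists w, u; split=> //; last exact: IH hu.
  exact: addr_subst hw.
- by move=> [w -> hw]; exists w => //; exact: addr_subst hw.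
- move=> [m [n [-> hm hn]]]; have [H1 H2] := cfl _ _ H.
  by exists m, n; split=> //; [apply: IHM hm|apply: IHN hn].
- move=> [w [u [-> hw hu]]]; exists w, u; split=> //; last exact: IH hu.
  exact: addr_subst hw.
- move=> [w [u [-> hw hu]]]; exists w, u; split=> //; last exact: IH hu.
  exact: addr_subst hw.
Qed.

(** Renaming also has the converse of [tr_subst]: a variable replaces addresses as well, so no
    information is lost to junk. *)
Lemma tr_rename rho x y P t : y \notin bv P ->
  tr rho (rename x y P) t <-> tr (upd rho x (rho y)) P t.
Proof.
move=> yP; split; last first.
  apply: tr_subst => // z zP; rewrite inE; apply/eqP => zy.
  by rewrite -zy zP in yP.
have addrE f z w : addr f (subst_var (PVar y) x z) w -> addr (upd f x (f y)) z w.
  by rewrite /addr /upd /subst_var; case: eqP.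
have extE f z : z != x -> y != z ->
    upd (ext f z) x (ext f z y) =1 ext (upd f x (f y)) z.
  move=> zx yz u; have -> : ext f z y = ren S (f y) by rewrite /ext (negbTE yz).
  by rewrite ext_upd.
have updE f z v : z != x -> y != z ->
    upd (upd f z v) x (upd f z v y) =1 upd (upd f x (f y)) z v.
  move=> zx yz u; have -> : upd f z v y = f y by rewrite /upd (negbTE yz).
  by rewrite [RHS]upd_upd.
rewrite /rename.
elim: P rho t yP => [|z|z M IH|M IH|M IHM N IHN|z M IHM N IHN|z M IH|z W IH|z W IH|z|M IHM N IHN|z W IH|z W IH] rho t /=;
  rewrite ?inE ?negb_or ?mem_cat ?negb_or //.
- by move=> _; rewrite /upd; case: eqP.
- move=> /andP[yz yM]; case: ifPn => [/eqP ->|zx] [m -> hm]; exists m => //.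
    by move: hm; apply: tr_eq1 => u; rewrite ext_upd_same.
  by apply: tr_eq1 (IH _ _ yM hm); apply: extE.
- by move=> yM [m -> /(IH _ _ yM)]; exists m.
- by move=> /andP[yM yN] [m [n [-> /(IHM _ _ yM) hm /(IHN _ _ yN) hn]]]; exists m, n.
- move=> /and3P[yz yM yN] [m [n [-> /(IHM _ _ yM) hm hn]]].
  exists m, n; split=> //; move: hn; case: ifPn => [/eqP -> hn|zx /(IHN _ _ yN) hn].
    by move: hn; apply: tr_eq1 => u; rewrite ext_upd_same.
  by apply: tr_eq1 hn; apply: extE.
- move=> /andP[yz yM]; case: ifPn => [/eqP ->|zx] [r hm]; exists r.
    by move: hm; apply: tr_eq1 => u; rewrite upd_upd_same.
  by apply: tr_eq1 (IH _ _ yM hm); apply: updE.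
- by move=> yW [w [v [-> /addrE hw /(IH _ _ yW) hv]]]; exists w, v.
- by move=> yW [w [v [-> /addrE hw /(IH _ _ yW) hv]]]; exists w, v.
- by move=> _ [w -> /addrE hw]; exists w.
- by move=> /andP[yM yN] [m [n [-> /(IHM _ _ yM) hm /(IHN _ _ yN) hn]]]; exists m, n.
- by move=> yW [w [v [-> /addrE hw /(IH _ _ yW) hv]]]; exists w, v.
- by move=> yW [w [v [-> /addrE hw /(IH _ _ yW) hv]]]; exists w, v.
Qed.

(** Bound names leave no trace: those of [lambda] and [let] become indices, those of [nu] region
    constants. *)
Lemma tr_alpha P Q : alpha P Q -> forall rho t, tr rho P t <-> tr rho Q t.
Proof.
have fresh y M : y \notin allvars M -> y \notin fv M /\ y \notin bv M.
  by rewrite mem_cat negb_or => /andP.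
have ext_rename x y M f m : y \notin allvars M ->
    tr (ext f x) M m <-> tr (ext f y) (rename x y M) m.
  move=> /fresh [yf yb]; rewrite tr_rename //; have -> : ext f y y = tvar 0 by rewrite /ext eqxx.
  have E z : z \in fv M -> ext f x z = upd (ext f y) x (tvar 0) z.
    move=> zM; rewrite /upd /ext; case: (z =P x) => // _.
    by case: eqP => // zy; rewrite -zy zM in yf.
  by split; apply: tr_ext => z /E.
elim=> {P Q} /=.
- by [].
- by move=> P Q _ IH rho t; rewrite IH.
- by move=> P Q T _ IH1 _ IH2 rho t; rewrite IH1.
- by move=> x y M yM rho t; split=> -[m -> /(ext_rename x y M _ _ yM)]; exists m.
- move=> x y M N yN rho t.
  by split=> -[m [n [-> hm /(ext_rename x y N _ _ yN) hn]]]; exists m, n.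
- move=> x y M /fresh [yf yb] rho t.
  have E r z : z \in fv M -> upd rho x (treg r) z = upd (upd rho y (treg r)) x (treg r) z.
    move=> zM; rewrite /upd; case: (z =P x) => // _.
    by case: eqP => // zy; rewrite -zy zM in yf.
  have rn r : tr (upd rho y (treg r)) (rename x y M) t <->
      tr (upd (upd rho y (treg r)) x (treg r)) M t.
    rewrite tr_rename //.
    by have -> : upd rho y (treg r) y = treg r by rewrite /upd eqxx.
  split=> -[r h]; exists r.
    by apply/rn; apply: tr_ext h => z /E.
  by move/rn: h; apply: tr_ext => z /E.
- by move=> x M M' _ IH rho t; split=> -[m -> /IH]; exists m.
- by move=> M M' _ IH rho t; split=> -[m -> /IH]; exists m.
- by move=> M M' N _ IH rho t; split=> -[m [n [-> /IH hm hn]]]; exists m, n.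
- by move=> M N N' _ IH rho t; split=> -[m [n [-> hm /IH hn]]]; exists m, n.
- by move=> x M M' N _ IH rho t; split=> -[m [n [-> /IH hm hn]]]; exists m, n.
- by move=> x M N N' _ IH rho t; split=> -[m [n [-> hm /IH hn]]]; exists m, n.
- by move=> x M M' _ IH rho t; split=> -[r /IH h]; exists r.
- by move=> x V V' _ IH rho t; split=> -[w [v [-> hw /IH hv]]]; exists w, v.
- by move=> x V V' _ IH rho t; split=> -[w [v [-> hw /IH hv]]]; exists w, v.
- by move=> P P' Q _ IH rho t; split=> -[m [n [-> /IH hm hn]]]; exists m, n.
- by move=> P Q Q' _ IH rho t; split=> -[m [n [-> hm /IH hn]]]; exists m, n.
- by move=> x V V' _ IH rho t; split=> -[w [v [-> hw /IH hv]]]; exists w, v.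
- by move=> x V V' _ IH rho t; split=> -[w [v [-> hw /IH hv]]]; exists w, v.
Qed.

(** A [nu] amounts to a choice of constant for [x]; the parts of [E] do not mention [x] and cannot
    see where the choice is made. *)
Lemma tr_extrude E rho x M t : x \notin fvE E ->
  tr rho (fillE E (PNu x M)) t <-> tr rho (PNu x (fillE E M)) t.
Proof.
elim: E t => [|E IH N|V E IH|E IH|y E IH N] t //=.
- rewrite mem_cat negb_or => /andP[/IH {}IH xN]; split.
    move=> [m [n [-> /IH [r hm] hn]]]; exists r, m, n; split=> //.
    exact/tr_upd_fresh.
  move=> [r [m [n [-> hm /(tr_upd_fresh _ _ _ xN) hn]]]]; exists m, n; split=> //.
  by apply/IH; exists r.
- rewrite mem_cat negb_or => /andP[xV /IH {}IH]; split.
    move=> [m [n [-> hm /IH [r hn]]]]; exists r, m, n; split=> //.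
    exact/tr_upd_fresh.
  move=> [r [m [n [-> /(tr_upd_fresh _ _ _ xV) hm hn]]]]; exists m, n; split=> //.
  by apply/IH; exists r.
- move=> /IH {}IH; split.
    by move=> [m -> /IH [r hm]]; exists r, m.
  by move=> [r [m -> hm]]; exists m => //; apply/IH; exists r.
- rewrite mem_cat negb_or mem_filter => /andP[/IH {}IH xN].
  have E1 r : {in fv N, ext rho y =1 ext (upd rho x (treg r)) y}.
    move=> z zN; rewrite /ext /upd; case: eqP => // /eqP zy.
    by case: eqP => // zx; rewrite -zx zN zy in xN.
  split.
    move=> [m [n [-> /IH [r hm] hn]]]; exists r, m, n; split=> //.
    exact: tr_ext (E1 r) hn.
  move=> [r [m [n [-> hm hn]]]]; exists m, n; split=> //.
    by apply/IH; exists r.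
  by apply: tr_ext hn => z /(E1 r).
Qed.

(** * Structural equivalence after erasure *)

Inductive teq : tm -> tm -> Prop :=
| teq_refl t : teq t t
| teq_sym t u : teq t u -> teq u t
| teq_trans t u v : teq t u -> teq u v -> teq t v
| teq_comm t u : teq (tpar t u) (tpar u t)
| teq_assoc t u v : teq (tpar (tpar t u) v) (tpar t (tpar u v))
| teq_parl t t' u : teq t t' -> teq (tpar t u) (tpar t' u)
| teq_parr t u u' : teq u u' -> teq (tpar t u) (tpar t u').

(** Only commutativity and associativity of parallel composition survive erasure; the other axioms
    relate both programs to the same term. Proving both directions at once handles symmetry. *)
Lemma tr_sc P Q : sc P Q ->
  (forall rho t, tr rho P t -> exists2 u, tr rho Q u & teq t u) /\
  (forall rho t, tr rho Q t -> exists2 u, tr rho P u & teq t u).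
Proof.
have iffS P' Q' : (forall rho t, tr rho P' t <-> tr rho Q' t) ->
    (forall rho t, tr rho P' t -> exists2 u, tr rho Q' u & teq t u) /\
    (forall rho t, tr rho Q' t -> exists2 u, tr rho P' u & teq t u).
  by move=> h; split=> rho t /h ht; exists t => //; apply: teq_refl.
elim=> {P Q}.
- by move=> P _; apply: iffS.
- by move=> P Q _ [h1 h2].
- move=> P Q T _ [h1 h2] _ [h3 h4]; split=> rho t.
    by move=> /h1 [u /h3 [v hv uv] tu]; exists v => //; apply: teq_trans uv.
  by move=> /h4 [u /h2 [v hv uv] tu]; exists v => //; apply: teq_trans uv.
- by move=> P Q _ /tr_alpha h; apply: iffS.
- move=> P Q _ _; split=> rho t /= [m [n [-> hm hn]]].
    by exists (tpar n m); [exists n, m|apply: teq_comm].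
  by exists (tpar n m); [exists n, m|apply: teq_comm].
- move=> P Q T _ _ _; split=> rho t /=.
    move=> [pq [n [-> [p [q [-> hp hq]]] hn]]].
    exists (tpar p (tpar q n)); last exact: teq_assoc.
    by exists p, (tpar q n); split=> //; exists q, n.
  move=> [p [qn [-> hp [q [n [-> hq hn]]]]]].
  exists (tpar (tpar p q) n); last exact/teq_sym/teq_assoc.
  by exists (tpar p q), n; split=> //; exists p, q.
- move=> x P Q _ _ xQ; apply: iffS => rho t /=; split.
    move=> [m [n [-> [r hm] hn]]]; exists r, m, n; split=> //.
    exact/tr_upd_fresh.
  move=> [r [m [n [-> hm /(tr_upd_fresh _ _ _ xQ) hn]]]].
  by exists m, n; split=> //; exists r.
- by move=> x E M _ _ xE; apply: iffS => rho t; apply: tr_extrude.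
- move=> P P' Q _ [h1 h2] _; split=> rho t /= [m [n [-> hm hn]]].
    by have [u hu mu] := h1 _ _ hm; exists (tpar u n); [exists u, n|apply: teq_parl].
  by have [u hu mu] := h2 _ _ hm; exists (tpar u n); [exists u, n|apply: teq_parl].
- move=> P Q Q' _ [h1 h2] _; split=> rho t /= [m [n [-> hm hn]]].
    by have [u hu mu] := h1 _ _ hn; exists (tpar m u); [exists m, u|apply: teq_parr].
  by have [u hu mu] := h2 _ _ hn; exists (tpar m u); [exists m, u|apply: teq_parr].
- move=> x P P' _ [h1 h2]; split=> rho t /= [r].
    by move=> /h1 [u hu tu]; exists u => //; exists r.
  by move=> /h2 [u hu tu]; exists u => //; exists r.
Qed.

(** * Termination of thread multisets, and simulation of source reductions *)

Section Simulation.

Local Notation "l1 ++ l2" := (app l1 l2) : seq_scope.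

Variable Phi : region -> tm -> Prop.

Notation everywhere := (fun _ : region => True).
Notation anything := (fun _ : tm => True).

(** [Red] rejects store items, so whole programs need this coarser predicate. A thread may touch all
    regions and end in any value; what counts is that it terminates and writes only readable
    values. *)
Fixpoint Good (t : tm) : Prop :=
  match t with
  | tpar a b => Good a /\ Good b
  | tst w v => exists2 r, w = treg r & Phi r v
  | _ => Red Phi everywhere anything t
  end.

Lemma Red_Good Q t : Red Phi everywhere Q t -> Good t.
Proof.
elim: t Q => [|n|r|t _|t _|t _ u _|t _ u _|w _ v _|w _|t IHt u IHu|w _ v _] Q /= h;
  try by apply: Red_mono h.
- inversion h as [|Q' t' _ _ _ _ ha hb]; subst=> //.
  by split; [apply: IHt (ha _ _ erefl)|apply: IHu (hb _ _ erefl)].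
- by inversion h as [|Q' t' _ hst _ _ _ _]; subst=> //; case: (hst w v).
Qed.

(* The threads of a program. Store items are dropped: reading may return any
   value of [Phi], so they play no part in the reduction of the threads. *)
Fixpoint thr (t : tm) : list tm :=
  match t with
  | tpar a b => thr a ++ thr b
  | tst _ _ => [::]
  | _ => [:: t]
  end.

Lemma lstep_atom t l t' : lstep t l t' -> atom t.
Proof. by case. Qed.

Lemma atom_thr t : atom t -> thr t = [:: t].
Proof. by case: t. Qed.

Lemma atom_Good t : atom t -> Good t -> Red Phi everywhere anything t.
Proof. by case: t. Qed.

(** Rewriting of lists up to permutation, that is, of multisets. The reduct contributes [thr x']
    because a step may expose a parallel composition and so split a thread. *)
Definition mstep (l l' : list tm) : Prop :=
  exists x lb x' k, [/\ lstep x lb x', lok Phi lb,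
    Permutation l (x :: k) & Permutation l' (thr x' ++ k)].

Notation macc := (Acc (fun l' l => mstep l l')).

Lemma mstep_perm l1 l2 l1' l2' : Permutation l1 l2 -> Permutation l1' l2' ->
  mstep l1 l1' -> mstep l2 l2'.
Proof.
move=> p p' [x [lb [x' [k [h ok pl pl']]]]]; exists x, lb, x', k; split=> //.
- exact: Permutation_trans (Permutation_sym p) pl.
- exact: Permutation_trans (Permutation_sym p') pl'.
Qed.

Lemma mstep_appl l l' k : mstep l l' -> mstep (l ++ k) (l' ++ k).
Proof.
move=> [x [lb [x' [k' [h ok pl pl']]]]]; exists x, lb, x', (k' ++ k); split=> //.
- exact: (Permutation_app_tail k pl).
- by rewrite app_assoc; apply: Permutation_app_tail.
Qed.

Lemma mstep_appr l l' k : mstep l l' -> mstep (k ++ l) (k ++ l').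
Proof.
move=> /(mstep_appl k); apply: mstep_perm; exact: Permutation_app_comm.
Qed.

Lemma macc_perm l l' : Permutation l l' -> macc l -> macc l'.
Proof.
move=> p [h]; constructor=> y hy; apply: h.
by apply: mstep_perm hy; [apply: Permutation_sym|].
Qed.

(** Threads do not interact, so termination of both parts is enough: nested induction on the
    accessibility proofs, by the side on which the moving thread lies. *)
Lemma macc_app l1 l2 : macc l1 -> macc l2 -> macc (l1 ++ l2).
Proof.
move=> h1 h2; elim: h1 l2 h2 => {}l1 _ IH1 l2 h2.
elim: h2 => {}l2 h2' IH2; have h2 : macc l2 := Acc_intro _ h2'.
constructor=> y [x [lb [x' [k [h ok p p']]]]].
have xl : In x (l1 ++ l2) by apply: Permutation_in (Permutation_sym p) _; left.
have [xl1|xl2] := in_app_or _ _ _ xl.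
- have [a [b E]] := in_split _ _ xl1; subst.
  have s1 : mstep (a ++ x :: b) (thr x' ++ (a ++ b)).
    exists x, lb, x', (a ++ b); split=> //.
    exact/Permutation_sym/Permutation_middle.
  apply: macc_perm (IH1 _ s1 _ h2); apply: Permutation_sym.
  apply: Permutation_trans p' _; rewrite -app_assoc.
  apply: Permutation_app_head; rewrite -app_assoc.
  rewrite -app_assoc /= in p.
  (* Cancelling [x] shows that [k] is a permutation of [a ++ b ++ l2]. *)
  exact: Permutation_cons_app_inv (Permutation_sym p).
- have [a [b E]] := in_split _ _ xl2; subst.
  have s2 : mstep (a ++ x :: b) (thr x' ++ (a ++ b)).
    exists x, lb, x', (a ++ b); split=> //.
    exact/Permutation_sym/Permutation_middle.
  apply: macc_perm (IH2 _ s2); apply: Permutation_sym.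
  apply: Permutation_trans p' _.
  rewrite app_assoc in p.
  have pk := Permutation_cons_app_inv _ _ (Permutation_sym p).
  apply: Permutation_trans (Permutation_app_head _ pk) _.
  (* The bystanders are [l1 ++ a ++ b]; it remains to exchange [l1] with [thr x']. *)
  rewrite -(app_assoc l1 a) (app_assoc (thr x')) (app_assoc l1 (thr x')).
  apply: Permutation_app_tail.
  exact: Permutation_app_comm.
Qed.

Lemma macc_thread t :
  (forall lb t', lstep t lb t' -> lok Phi lb -> macc (thr t')) -> macc [:: t].
Proof.
move=> H; constructor=> y [x [lb [x' [k [h ok p p']]]]].
have [E1 E2] := Permutation_length_1_inv p; subst.
apply: macc_perm (H _ _ h ok); apply: Permutation_sym.
by rewrite app_nil_r in p'.
Qed.

(** The step premise of [Red] gives accessibility of a lone thread, and the two sides of a [tpar]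
    combine by [macc_app]. *)
Lemma macc_Red Q t : Red Phi everywhere Q t -> macc (thr t).
Proof.
elim=> {Q}{}t.
  move=> v vv _; have tv : atom v by case: v vv.
  by rewrite (atom_thr tv); apply: macc_thread => l t' /tval_lstep.
move=> {}t _ hst _ _ IH _ IHa _ IHb.
have at_t : atom t -> macc (thr t).
  by move=> /atom_thr ->; apply: macc_thread.
case: t hst IH IHa IHb at_t => [|n|r|b|b|b c|b c|w v|w|a b|w v] hst IH IHa IHb at_t;
  try apply: (at_t I).
- exact: macc_app (IHa _ _ erefl) (IHb _ _ erefl).
- by case: (hst w v).
Qed.

Lemma macc_Good t : Good t -> macc (thr t).
Proof.
elim: t => [|n|r|t _|t _|t _ u _|t _ u _|w _ v _|w _|t IHt u IHu|w _ v _] h;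
  try exact: macc_Red h.
- by case: h => /IHt ht /IHu hu; apply: macc_app.
- by constructor=> y [x [lb [x' [k [_ _ /Permutation_nil]]]]].
Qed.

Lemma Good_lstep t lb t' : Good t -> lstep t lb t' -> lok Phi lb ->
  Good t' /\ mstep (thr t) (thr t').
Proof.
move=> ht h ok; have ta := lstep_atom h; split.
  have := atom_Good ta ht => hr; inversion hr as [? ? hv|? ? _ _ _ hs]; subst.
    by case: (tval_lstep h hv).
  exact: Red_Good (hs _ _ h ok).
rewrite (atom_thr ta); exists t, lb, t', [::]; split=> //.
by rewrite app_nil_r.
Qed.

Lemma Good_lsafe t lb t' : Good t -> lstep t lb t' -> lsafe Phi everywhere lb.
Proof.
move=> ht h; have ta := lstep_atom h.
have := atom_Good ta ht => hr; inversion hr as [? ? hv|? ? _ _ hs]; subst.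
  by case: (tval_lstep h hv).
exact: hs h.
Qed.

Lemma teq_Good t u : teq t u -> Good t <-> Good u.
Proof.
elim=> //= {t u}.
- by move=> t u _ ->.
- by move=> t u v _ -> _ ->.
- by move=> t u; split=> -[].
- by move=> t u v; tauto.
- by move=> t t' u _ ->.
- by move=> t u u' _ ->.
Qed.

Lemma teq_thr t u : teq t u -> Permutation (thr t) (thr u).
Proof.
elim=> //= {t u}.
- by move=> t u _ /Permutation_sym.
- by move=> t u v _ h _; apply: Permutation_trans h.
- by move=> t u; apply: Permutation_app_comm.
- by move=> t u v; rewrite app_assoc.
- by move=> t t' u _; apply: Permutation_app_tail.
- by move=> t u u' _; apply: Permutation_app_head.
Qed.

(** [f] is one erasure of [E] with its region constants fixed, so that filling the hole anew does
    not change the constants chosen for the [nu] binders inside [E]. *)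
Lemma tr_fillE rho E M t :
  ectx_ok E -> (forall x, tval (rho x)) -> tr rho (fillE E M) t ->
  exists (f : tm -> tm) m, [/\ t = f m, tr rho M m,
    forall M' m', tr rho M' m' -> tr rho (fillE E M') (f m') &
    forall m1 lb m2, lstep m1 lb m2 -> lstep (f m1) lb (f m2)].
Proof.
move=> hE hr; elim: E hE t => [|E IH N|V E IH|E IH|y E IH N] /= hE t.
- by move=> ht; exists id, t.
- move=> [m [n [-> /(IH (proj1 hE)) [f [m0 [-> hm0 hf hs]]] hn]]].
  exists (fun u => tapp (f u) n), m0; split=> // [M' m' /hf h|m1 lb m2 /hs].
    by exists (f m'), n.
  exact: ls_appl.
- move=> [m [n [-> hm /(IH (proj2 hE)) [f [m0 [-> hm0 hf hs]]]]]].
  exists (fun u => tapp m (f u)), m0; split=> // [M' m' /hf h|m1 lb m2 /hs].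
    by exists m, (f m').
  by apply: ls_appr; apply: tr_val hm; first exact: (proj1 hE).
- move=> [m -> /(IH hE) [f [m0 [-> hm0 hf hs]]]].
  exists (fun u => tbang (f u)), m0; split=> // [M' m' /hf h|m1 lb m2 /hs].
    by exists (f m').
  exact: ls_bang.
- move=> [m [n [-> /(IH (proj1 hE)) [f [m0 [-> hm0 hf hs]]] hn]]].
  exists (fun u => tlet (f u) n), m0; split=> // [M' m' /hf h|m1 lb m2 /hs].
    by exists (f m'), n.
  exact: ls_letl.
Qed.

Lemma tr_inst rho x V v M m :
  is_value V -> capture_free V M -> tr rho V v -> tr (ext rho x) M m ->
  tr rho (subst V x M) (sub (inst v) m).
Proof.
move=> hV hc hv /(tr_sub (inst v)) hm; apply: (tr_subst hV hc hv).
by apply: tr_eq1 hm => y; rewrite /ext /upd; case: eqP => //= _; rewrite sub_inst_shift.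
Qed.

(** Safety makes the address of the erased read a region constant, and [Good] does so for the store
    item. Both erase [x], so the stored value is one that the read may return. *)
Lemma sim_read rho E x V w v t :
  ectx_ok E -> (forall y, tval (rho y)) -> tr rho V v -> addr rho x w ->
  tr rho (fillE E (PGet x)) t -> Good t -> Good (tst w v) ->
  exists t', [/\ tr rho (fillE E V) t', Good t' & mstep (thr t) (thr t')].
Proof.
move=> hE hr hv hw ht gt [r E2 pr].
have [f [m [Et [w' Em hw'] hf hs]]] := tr_fillE hE hr ht; subst.
have st : lstep (f (tget w')) (Lrd w' v) (f v) by apply/hs/ls_get.
have [r' Ew _] := Good_lsafe gt st.
(* Constants are not junk, so each address equals [rho x]. *)
have Er : treg r = treg r' by move: hw' hw; rewrite /addr Ew => -[->|//] [->|//].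
have ok : lok Phi (Lrd w' v) by exists r => //; rewrite Ew -Er.
have [g' ms] := Good_lstep gt st ok.
by exists (f v); split=> //; apply: hf.
Qed.

Lemma sim_basic rho D D' t : basic D D' -> (forall x, tval (rho x)) ->
  tr rho D t -> Good t ->
  exists t', [/\ tr rho D' t', Good t' & mstep (thr t) (thr t')].
Proof.
(* Shared by [set] and [pset], for which [D0] stands. Safety of the write label gives the
   readability that makes the new store item good. *)
have sim_write E x V D0 (t0 : tm) :
    ectx_ok E -> (forall y, tval (rho y)) ->
    (forall m, tr rho D0 m -> exists w v, [/\ m = tset w v, addr rho x w & tr rho V v]) ->
    tr rho (fillE E D0) t0 -> Good t0 ->
    exists m w v, [/\ tr rho (fillE E PUnit) m, addr rho x w, tr rho V v,
      Good (tpar m (tst w v)) & mstep (thr t0) (thr m ++ [::])].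
  move=> hE hr hD ht gt.
  have [f [m [Et hm hf hs]]] := tr_fillE hE hr ht.
  have [w [v [Em hw hv]]] := hD _ hm; subst.
  have st : lstep (f (tset w v)) (Lwr w v) (f tunit) by apply/hs/ls_set.
  have [r Ew [_ pr]] := Good_lsafe gt st.
  have [g' ms] := Good_lstep gt st I.
  exists (f tunit), w, v; rewrite app_nil_r; split=> //; first exact: hf.
  by split=> //; exists r.
case=> {D D'} [E x M V hE hM hV hc|E x V M hE hM hV hc|E x V hE hV|E x V hE hV|E x V hE hV|E x V hE hV] hr.
- move=> ht gt; have [f [m [Et hm hf hs]]] := tr_fillE hE hr ht; subst.
  have [l [v [Em [b El hb] hv]]] := hm; subst.
  have st := hs _ _ _ (ls_beta b (tr_val hV hr hv)).
  have [g' ms] := Good_lstep gt st I.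
  by exists (f (sub (inst v) b)); split=> //; apply/hf/tr_inst.
- move=> ht gt; have [f [m [Et hm hf hs]]] := tr_fillE hE hr ht; subst.
  have [l [b [Em [v El hv] hb]]] := hm; subst.
  have st := hs _ _ _ (ls_let b (tr_val hV hr hv)).
  have [g' ms] := Good_lstep gt st I.
  by exists (f (sub (inst v) b)); split=> //; apply/hf/tr_inst.
- move=> ht gt.
  have [m [w [v [hm hw hv g ms]]]] :=
    sim_write E x V (PSet x V) t hE hr (fun m h => h) ht gt.
  by exists (tpar m (tst w v)); split=> //; exists m, (tst w v); split=> //; exists w, v.
- move=> ht gt.
  have [m [w [v [hm hw hv g ms]]]] :=
    sim_write E x V (PPSet x V) t hE hr (fun m h => h) ht gt.
  by exists (tpar m (tst w v)); split=> //; exists m, (tst w v); split=> //; exists w, v.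
- move=> [m [n [-> hm [w [v [-> hw hv]]]]]] [gm gn].
  have [t' [h1 h2 h3]] := sim_read hE hr hv hw hm gm gn.
  by exists t'; split=> //=; rewrite app_nil_r.
- move=> [m [n [-> hm [w [v [-> hw hv]]]]]] [gm gn].
  have [t' [h1 h2 h3]] := sim_read (V := PBang V) hE hr hv hw hm gm gn.
  exists (tpar t' (tst w v)); split=> //=; last by rewrite !app_nil_r.
  by exists t', (tst w v); split=> //; exists w, v.
Qed.

Lemma sim_fillS C rho D D' t : basic D D' -> (forall x, tval (rho x)) ->
  tr rho (fillS C D) t -> Good t ->
  exists t', [/\ tr rho (fillS C D') t', Good t' & mstep (thr t) (thr t')].
Proof.
move=> hD; elim: C rho t => [|C IH P|P C IH|x C IH] rho t hr /=.
- exact: sim_basic.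
- move=> [m [n [-> hm hn]]] [gm gn]; have [m' [h1 h2 h3]] := IH _ _ hr hm gm.
  by exists (tpar m' n); split=> //=; [exists m', n|apply: mstep_appl].
- move=> [m [n [-> hm hn]]] [gm gn]; have [n' [h1 h2 h3]] := IH _ _ hr hn gn.
  by exists (tpar m n'); split=> //=; [exists m, n'|apply: mstep_appr].
- move=> [r ht] gt.
  have hr' y : tval (upd rho x (treg r) y) by rewrite /upd; case: eqP.
  by have [t' [h1 h2 h3]] := IH _ _ hr' ht gt; exists t'; split=> //; exists r.
Qed.

Lemma sim_red rho P P' t : red P P' -> (forall x, tval (rho x)) ->
  tr rho P t -> Good t ->
  exists t', [/\ tr rho P' t', Good t' & mstep (thr t) (thr t')].
Proof.
move=> [C [D [D' [hD [/tr_sc [h1 _] /tr_sc [_ h2]]]]]] hr /h1 [t1 ht1 e1] gt.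
have [t2 [ht2 g2 s2]] := sim_fillS hD hr ht1 (proj1 (teq_Good e1) gt).
have [t3 ht3 e3] := h2 _ _ ht2; exists t3; split=> //.
  exact/(teq_Good e3).
apply: mstep_perm s2; last exact: teq_thr.
exact/Permutation_sym/teq_thr.
Qed.

(** Each source reduction is an [mstep] of the threads, so an infinite one would descend forever
    among accessible lists. *)
Lemma Good_terminates rho P t : (forall x, tval (rho x)) ->
  tr rho P t -> Good t ->
  ~ (exists f : nat -> prog, f 0 = P /\ forall n, red (f n) (f n.+1)).
Proof.
move=> hr ht gt [f [f0 fS]].
have : forall l, macc l -> forall n t, l = thr t -> tr rho (f n) t -> Good t -> False.
  move=> l; elim=> {}l _ IH n u El hu gu; subst.
  have [u' [hu' gu' su]] := sim_red (fS n) hr hu gu.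
  exact: IH su n.+1 u' erefl hu' gu'.
by move=> /(_ _ (macc_Good gt) 0 t erefl); rewrite f0; apply.
Qed.

End Simulation.

(** * Soundness of typing for the candidates *)

Section Soundness.

Variable Phi : region -> tm -> Prop.

Local Notation mem_eff e := (fun r : region => r \in e).

Lemma Red_set (e : region -> Prop) (Q : tm -> Prop) r v :
  e r -> Phi r v -> Q tunit -> Red Phi e Q (tset (treg r) v).
Proof.
move=> er pv qu; apply: Red_step => // l t' h; inversion h; subst; first by exists r.
by move=> _; apply: Red_val.
Qed.

Lemma Red_get (e : region -> Prop) (Q : tm -> Prop) r :
  e r -> (forall v, Phi r v -> tval v /\ Q v) -> Red Phi e Q (tget (treg r)).
Proof.
move=> er H; apply: Red_step => // l t' h; inversion h; subst; first by exists r.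
by move=> [r' [<-] /H [tv qv]]; apply: Red_val.
Qed.

Lemma Red_par (e : region -> Prop) (Q : tm -> Prop) a b :
  Red Phi e (fun _ => True) a -> Red Phi e (fun _ => True) b ->
  Red Phi e Q (tpar a b).
Proof.
move=> ha hb; apply: Red_step => //; try by move=> l t' h; inversion h.
- by move=> c d [<- _].
- by move=> c d [_ <-].
Qed.

(** Values are required at all variables, also outside [G], so that every source value erases to a
    value along [s]. *)
Definition sem (s : var -> tm) (G : ctx) : Prop :=
  (forall x, tval (s x)) /\
  forall x u A, lookup G x = Some (u, A) -> RED Phi A (s x).

Lemma lookup_rcons G x p y : x \notin dom G ->
  lookup (rcons G (x, p)) y = if y == x then Some p else lookup G y.
Proof.
elim: G => [|[z q] G IH] /=; first by rewrite eq_sym.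
rewrite inE negb_or => /andP[xz /IH ->].
case: (z =P y) => // <-; by rewrite eq_sym (negbTE xz).
Qed.

Lemma lookup_In G x p : lookup G x = Some p -> In (x, p) G.
Proof.
elim: G => [|[z q] G IH] //=; case: eqP => [-> [->]|_ /IH]; by [left|right].
Qed.

Lemma sem_rcons s G x u A v : ctx_ok (rcons G (x, (u, A))) ->
  sem s G -> RED Phi A v -> sem (upd s x v) (rcons G (x, (u, A))).
Proof.
move=> [+ _] [sv sG] hv; rewrite /dom map_rcons rcons_uniq => /andP[xG _].
split=> [y|y w B]; rewrite /upd.
  by case: eqP => // _; apply: RED_tval hv.
rewrite lookup_rcons //; case: eqP => [_ [_ <-] //|_]; exact: sG.
Qed.

Lemma sem_sum s G1 G2 G : ctx_sum G1 G2 G -> sem s G -> sem s G1 /\ sem s G2.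
Proof.
move=> [_ [_ [_ H]]] [sv sG].
split; split=> // x u A E; have := H x; rewrite E /=.
- case: (lookup G2 x) => [[u' A'] [w [_ [_ h]]]|h]; exact: sG h.
- case: (lookup G1 x) => [[u' A'] [w [<- [_ h]]]|h]; exact: sG h.
Qed.

(** Lets a binder be erased by first treating [x] as a free index and then binding it, so that the
    induction hypothesis for the body applies. *)
Lemma sub_up_ext s x v m :
  sub (inst v) (sub (up s) (sub (ext tvar x) m)) = sub (upd s x v) m.
Proof.
rewrite !sub_sub; apply: sub_ext => y; rewrite /ext /upd.
by case: eqP => //= _; rewrite sub_inst_shift.
Qed.

Lemma sub_upd_reg s x r m :
  sub s (sub (upd tvar x (treg r)) m) = sub (upd s x (treg r)) m.
Proof. by rewrite sub_sub; apply: sub_ext => y; rewrite /upd; case: eqP. Qed.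

(** An entry of [G] provides a type well formed in [R], whence [R] itself is well formed, as
    saturation demands. *)
Lemma saturated_In R r U A G x u B : saturated Phi R -> wf_ctx R G ->
  lookup G x = Some (u, B) -> In (r, (U, A)) R ->
  forall v, Phi r v <-> RED Phi A v.
Proof.
move=> hR [_ hG] /lookup_In /hG /wf_vty_rctx wfR; exact: hR (emb_refl R) wfR.
Qed.

Lemma emb_In R R' r U A : emb R R' -> In (r, (U, A)) R ->
  exists U', In (r, (U', A)) R'.
Proof.
elim=> [{}R|s V V' B {}R {}R' _ IH|p {}R {}R' _ IH] //=.
- case=> [[-> _ ->]|/IH [U' h]]; first by exists V'; left.
  by exists U'; right.
- by move=> /IH [U' h]; exists U'; right.
Qed.

(** The type of [x] forces its image to be [treg r], and [r] carries in [R] the type [A] of the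
    stored value, so saturation makes reducible values readable. *)
Lemma sem_store R R' G G' x u r U A s :
  ctx_sum [:: (x, (u, TReg r A))] G' G -> rsum [:: (r, (U, A))] R' R ->
  wf_ctx R G -> saturated Phi R -> sem s G ->
  [/\ s x = treg r, sem s G' & forall v, RED Phi A v -> Phi r v].
Proof.
move=> hG /rsum_emb [h1 h2] wf sR sG.
have [s1 s2] := sem_sum hG sG.
have [U' hr] : exists U', In (r, (U', A)) R by apply: emb_In h1 _; left.
have [u' hx] : exists u', lookup G x = Some (u', TReg r A).
  have [_ [_ [_ /(_ x)]]] := hG; rewrite /= eqxx.
  case: (lookup G' x) => [[u2 A2] [u' [_ [_ ->]]]|->]; by [exists u'|exists u].
split=> //; last by move=> v; rewrite (saturated_In sR wf hx hr).
by apply: (proj2 s1 x u (TReg r A)); rewrite /= eqxx.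
Qed.

Lemma is_value_term V : is_value V -> is_term V.
Proof. by elim: V => //= M IH /IH. Qed.

Lemma is_term_prog M : is_term M -> is_prog M.
Proof. by elim: M => //=; auto; move=> M IHM N IHN [/IHM ? /IHN]. Qed.

Lemma is_store_not_term S : is_store S -> ~ is_term S.
Proof.
elim: S => //= [S IH S' _ [/IH h _] [/h]|_ V _ _ []|_ V _ _ []] //.
Qed.

(** Along [tvar] the free name [x] erases to the free index [x], so a valuation of names is also a
    substitution. A single [m] precedes all [s]: the region constants of [nu] come from the typing
    derivation. [Red] is claimed for terms only, as it rejects store items. *)
Definition sound (R : rctx) (G : ctx) (P : prog) (a : ty) (e : effect) : Prop :=
  exists2 m, tr tvar P m & forall s, sem s G -> Good Phi (sub s m) /\
    (is_term P -> Red Phi (mem_eff e) (REDty Phi a) (sub s m)).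

Lemma sound_term R G P a e :
  (exists2 m, tr tvar P m & forall s, sem s G ->
    Red Phi (mem_eff e) (REDty Phi a) (sub s m)) -> sound R G P a e.
Proof.
move=> [m hm H]; exists m => // s /H h; split=> // {H}.
by apply: (@Red_Good _ (REDty Phi a)); apply: Red_mono h.
Qed.

(** The fundamental lemma, by induction on typing. Premises over summands inherit saturation by
    embedding and their valuations by [sem_sum]; effects grow by [Red_mono]. *)
Lemma has_type_sound R G P a e :
  has_type R G P a e -> is_prog P -> saturated Phi R -> sound R G P a e.
Proof.
elim=> {R G P a e}.
- move=> R G M a e a' e' tM _ IH saa' /fsubsetP ee' _ pM sR.
  have [m hm H] := IH pM sR; apply: sound_term; exists m => // s /H [_ /(_ tM)].
  by apply: Red_mono => // v; apply: REDty_sub saa' v.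
- move=> R G x u A _ hx _ _; apply: sound_term; exists (tvar x) => // s [sv sG].
  by apply: Red_val => /=; [apply: sv|apply: sG hx].
- move=> R G _ _ _; apply: sound_term; exists tunit => // s _.
  exact: Red_val.
- move=> R G x A M a e ok _ IH [tM|//] sR.
  have [m hm H] := IH (is_term_prog (tM : is_term M)) sR.
  (* In [m] the argument is still the free index [x]; this substitution binds it. *)
  apply: sound_term; exists (tlam (sub (ext tvar x) m)).
    by exists (sub (ext tvar x) m) => //; apply: tr_sub hm.
  move=> s sG; apply: Red_val => //=; split=> // v hv.
  apply: Red_beta (RED_tval hv) _; rewrite sub_up_ext.
  exact: (proj2 (H _ (sem_rcons ok sG hv)) tM).
- move=> R1 R2 R G1 G2 G M N A e a e' e'' _ IH1 _ IH2 hR hG [[tM tN]|//] sR.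
  have [r1 r2] := rsum_emb hR.
  have [m hm H1] := IH1 (is_term_prog tM) (saturated_emb r1 sR).
  have [n hn H2] := IH2 (is_term_prog tN) (saturated_emb r2 sR).
  apply: sound_term; exists (tapp m n); first by exists m, n.
  move=> s /(sem_sum hG) [/H1 [_ /(_ tM) h1] /H2 [_ /(_ tN) h2]].
  apply: Red_app h1 h2 _ => [r|r|v1 v2 _ _ [_ h] /h]; rewrite ?inE.
  + by move=> ->; rewrite orbT.
  + by move=> ->; rewrite orbT.
  + by apply: Red_mono => // r; rewrite !inE => ->.
- move=> R R' R0 G G' G0 M A e hR hG _ _ _ IH _ [tM|//] sR.
  have [r1 r2] := rsum_emb hR.
  have [m hm H] := IH (is_term_prog (tM : is_term M)) (saturated_emb r1 sR).
  apply: sound_term; exists (tbang m); first by exists m.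
  move=> s /(sem_sum hG) [/H [_ /(_ tM) h] _].
  by apply: Red_bang h => v hv /=; exists v.
- move=> R1 R2 R G1 G2 G x M N A a e e' _ IH1 ok _ IH2 hR hG [[tM tN]|//] sR.
  have [r1 r2] := rsum_emb hR.
  have [m hm H1] := IH1 (is_term_prog tM) (saturated_emb r1 sR).
  have [n hn H2] := IH2 (is_term_prog tN) (saturated_emb r2 sR).
  apply: sound_term; exists (tlet m (sub (ext tvar x) n)).
    by exists m, (sub (ext tvar x) n); split=> //; apply: tr_sub hn.
  move=> s /(sem_sum hG) [/H1 [_ /(_ tM) h1] s2].
  apply: Red_let h1 _ => [r|_ _ [v -> hv]]; first by rewrite inE => ->.
  apply: Red_letbang (RED_tval hv) _; rewrite sub_up_ext.
  have [_ /(_ tN)] := H2 _ (sem_rcons ok s2 hv).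
  by apply: Red_mono => // r; rewrite !inE => ->; rewrite orbT.
- move=> R G x u r A P a e ok _ IH pP sR.
  have [m hm H] := IH pP sR.
  (* The constant chosen for [x] is the region named in its type. *)
  exists (sub (upd tvar x (treg r)) m); first by exists r; apply: tr_sub hm.
  move=> s sG; rewrite sub_upd_reg.
  by apply: H; apply: sem_rcons.
- move=> R G x u r v v' A wf hx hr _ _ sR.
  apply: sound_term; exists (tget (tvar x)); first by exists (tvar x) => //; left.
  move=> s [_ sG] /=; rewrite (sG _ _ _ hx).
  apply: Red_get => [|w]; first by rewrite inE.
  by rewrite (saturated_In sR wf hx hr) => h; split=> //; apply: RED_tval h.
- move=> R R' G G' x u r v v' A V hG _ hR _ wf _ IH [vV|//] sR.
  have tV := is_value_term (vV : is_value V).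
  have [m hm H] := IH (is_term_prog tV) (saturated_emb (proj2 (rsum_emb hR)) sR).
  apply: sound_term; exists (tset (tvar x) m).
    by exists (tvar x), m; split=> //; left.
  move=> s sG; have [/= -> s' hr] := sem_store hG hR wf sR sG.
  have tm_ : tval (sub s m) by apply: tr_val (tr_sub s hm) => //; case: sG.
  apply: Red_set => //; first by rewrite inE.
  (* A reducible value satisfies its postcondition, so the written value lies in the candidate of
     [A] and hence in [Phi r]. *)
  exact: hr (Red_tval (proj2 (H _ s') tV) tm_).
- move=> R R' G G' x u r v v' A V hG _ hR _ wf _ IH [//|vV] sR.
  have tV := is_value_term (vV : is_value V).
  have [m hm H] := IH (is_term_prog tV) (saturated_emb (proj2 (rsum_emb hR)) sR).
  exists (tst (tvar x) m); first by exists (tvar x), m; split=> //; left.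
  move=> s sG; have [/= -> s' hr] := sem_store hG hR wf sR sG.
  have tm_ : tval (sub s m) by apply: tr_val (tr_sub s hm) => //; case: sG.
  split=> //; exists r => //.
  exact: hr (Red_tval (proj2 (H _ s') tV) tm_).
- move=> R R' G G' x u r v v' A V hG _ hR _ wf _ IH [vV|//] sR.
  have tV := is_value_term (vV : is_value V).
  have [m hm H] := IH (is_term_prog tV) (saturated_emb (proj2 (rsum_emb hR)) sR).
  apply: sound_term; exists (tset (tvar x) m).
    by exists (tvar x), m; split=> //; left.
  move=> s sG; have [/= -> s' hr] := sem_store hG hR wf sR sG.
  have tm_ : tval (sub s m) by apply: tr_val (tr_sub s hm) => //; case: sG.
  apply: Red_set => //; first by rewrite inE.
  exact: hr (Red_tval (proj2 (H _ s') tV) tm_).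
- move=> R R' G G' x u r v v' A V hG _ hR _ wf _ IH [//|vV] sR.
  have tV := is_value_term (vV : is_value V).
  have [m hm H] := IH (is_term_prog tV) (saturated_emb (proj2 (rsum_emb hR)) sR).
  exists (tst (tvar x) m); first by exists (tvar x), m; split=> //; left.
  move=> s sG; have [/= -> s' hr] := sem_store hG hR wf sR sG.
  have tm_ : tval (sub s m) by apply: tr_val (tr_sub s hm) => //; case: sG.
  split=> //; exists r => //.
  exact: hr (Red_tval (proj2 (H _ s') tV) tm_).
- move=> R1 R2 R G1 G2 G P S a e _ IH1 _ IH2 hS hR hG [pP pS] sR.
  have [r1 r2] := rsum_emb hR.
  have [m hm H1] := IH1 pP (saturated_emb r1 sR).
  have [n hn H2] := IH2 pS (saturated_emb r2 sR).
  exists (tpar m n); first by exists m, n.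
  move=> s /(sem_sum hG) [/H1 [g1 _] /H2 [g2 _]]; split=> //.
  (* A parallel composition with a store is not a term, so the claim on [Red] is vacuous. *)
  by move=> [_ /(is_store_not_term hS)].
- move=> R1 R2 R G1 G2 G P S a e _ IH1 _ IH2 hS hR hG [pS pP] sR.
  have [r1 r2] := rsum_emb hR.
  have [m hm H1] := IH1 pP (saturated_emb r1 sR).
  have [n hn H2] := IH2 pS (saturated_emb r2 sR).
  exists (tpar n m); first by exists n, m.
  move=> s /(sem_sum hG) [/H1 [g1 _] /H2 [g2 _]]; split=> //.
  by move=> [/(is_store_not_term hS)].
- move=> R1 R2 R G1 G2 G P1 P2 a1 a2 e1 e2 _ IH1 _ IH2 _ _ hR hG [p1 p2] sR.
  have [r1 r2] := rsum_emb hR.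
  have [m hm H1] := IH1 p1 (saturated_emb r1 sR).
  have [n hn H2] := IH2 p2 (saturated_emb r2 sR).
  exists (tpar m n); first by exists m, n.
  move=> s /(sem_sum hG) [/H1 [g1 h1] /H2 [g2 h2]]; split=> // -[/h1 k1 /h2 k2].
  by apply: Red_par; [apply: Red_mono k1|apply: Red_mono k2] => // r;
    rewrite inE => ->; rewrite ?orbT.
Qed.

(** * Closing valuation and termination *)

Definition dflt_env (G : ctx) (x : var) : tm :=
  if lookup G x is Some (_, A) then dflt A else tunit.

Lemma sem_dflt_env G : sem (dflt_env G) G.
Proof.
split=> [x|x u A h]; rewrite /dflt_env; last by rewrite h; apply: RED_dflt.
by case: lookup => [[_ A]|] //; apply: RED_tval (RED_dflt Phi A).
Qed.

End Soundness.

Theorem mainTheorem8 (P : prog) (R : rctx) (G : ctx) (a : ty) (e : effect) :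
  is_prog P -> rctx_ok R -> ctx_ok G ->
  has_type R G P a e ->
  ~ (exists f : nat -> prog, f 0 = P /\ forall n, red (f n) (f n.+1)).
Proof.
move=> pP [uR _] _ hP.
have [m hm H] := has_type_sound hP pP (saturated_readable uR).
have sG := sem_dflt_env (readable (rev R)) G.
(* [tr_sub] turns the erasure along [tvar] into one along the default valuation, which closes [P] by
   reducible values. *)
exact: Good_terminates (proj1 sG) (tr_sub _ hm) (proj1 (H _ sG)).
Qed.
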